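(* Let $a\in\mathbb Z_+=\{0,1,2,\dots\}$, $b\in\mathbb R$, and let $\alpha$ be a multi-index with $|\alpha|\le\lfloor d/2\rfloor+1$. Then there exists a constant $N=N(d,a,b,\gamma,\nu)$ such that for all $\varepsilon\in(0,1)$ and all $s<t$, $$\int_{|\xi|\ge\varepsilon}|\hat q_{\alpha,a,b}(s,t,\xi)|^2\,d\xi\le N\,1_{a=b=0,\alpha\ne0}\Big(1+\varepsilon^{2(\gamma-|\alpha|)+d}+1_{2(\gamma-|\alpha|)=-d}\ln\varepsilon^{-1}\Big)$$ $$\qquad+N\big(1_{a\ne0}+1_{b\ne0}+1_{\alpha=0}\big)\Big(1+\varepsilon^{2(\gamma a+b-|\alpha|)+d}+1_{2(\gamma a+b-|\alpha|)=-d}\ln\varepsilon^{-1}\Big).$$ In particular, if either (i) $a=b=0$, $\alpha\neq0$ and $2(\gamma-|\alpha|)>-d$, or (ii) $2(\gamma a+b-|\alpha|)>-d$, then $$\sup_{s<t}\int_{\mathbb R^d}|\hat q_{\alpha,a,b}(s,t,\xi)|^2\,d\xi\le N(d,a,b,\gamma,\nu).$$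
   Context: Standing assumptions: $d\in\mathbb N$, $\gamma\in(0,\infty)$, $\nu>0$, and $\psi:\mathbb R\times\mathbb R^d\to\mathbb C$ is measurable with $\Re[\psi(t,\xi)]\le-\nu|\xi|^\gamma$ for all $(t,\xi)$ and $|D_\xi^\alpha\psi(t,\xi)|\le\nu^{-1}|\xi|^{\gamma-|\alpha|}$ for all $t\in\mathbb R$, $\xi\neq0$, $|\alpha|\le\lfloor d/2\rfloor+1$. For $s<t$, a multi-index $\alpha$, and $\xi\ne0$, $$\hat q_{\alpha,a,b}(s,t,\xi)=D_\xi^\alpha\Big[\big((t-s)\psi(t,(t-s)^{-1/\gamma}\xi)\big)^a|\xi|^b\exp\Big(\int_s^t\psi(r,(t-s)^{-1/\gamma}\xi)\,dr\Big)\Big].$$ $1_P$ equals $1$ if the condition $P$ holds and $0$ otherwise. (A zeroth power is $1$.) *)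

(* Defs.v *)
From HB Require Import structures.
From mathcomp Require Import all_boot all_order all_algebra.
From mathcomp Require Import all_classical all_reals all_analysis.
From mathcomp Require Import complex.

Set Implicit Arguments.
Unset Strict Implicit.
Unset Printing Implicit Defensive.

Import Order.TTheory GRing.Theory Num.Theory.
Import numFieldNormedType.Exports.

Local Open Scope classical_set_scope.
Local Open Scope complex_scope.
Local Open Scope ring_scope.

Local Notation Re := complex.Re.
Local Notation Im := complex.Im.

(** * Lebesgue measure on R^n

  R^n is ['rV[R]_n], with the product sigma-algebra, i.e. the one generated by
  the coordinates (the same construction as the library's one on tuples). *)

Definition rV_display : measure_display.
Proof. exact: default_measure_display. Qed.

Section rV_measurable.
Context {R : realType}.
Variable n : nat.

Let coord (i : 'I_n) (x : 'rV[R]_n) : R := x ord0 i.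

Let rV_set0 : g_sigma_preimage coord set0.
Proof. exact: sigma_algebra0. Qed.

Let rV_setC A : g_sigma_preimage coord A -> g_sigma_preimage coord (~` A).
Proof. exact: sigma_algebraC. Qed.

Let rV_bigcup (F : (set 'rV[R]_n)^nat) :
  (forall i, g_sigma_preimage coord (F i)) ->
  g_sigma_preimage coord (\bigcup_i (F i)).
Proof. exact: sigma_algebra_bigcup. Qed.

HB.instance Definition _ := @isMeasurable.Build rV_display
  'rV[R]_n (g_sigma_preimage coord) rV_set0 rV_setC rV_bigcup.

Lemma measurable_rV_coord (i : 'I_n) :
  measurable_fun [set: 'rV[R]_n] (fun x : 'rV[R]_n => x ord0 i).
Proof.
move=> _ Y mY; rewrite setTI; apply: sub_sigma_algebra => /=.
rewrite -bigcup_seq/=; exists i => /=; first by rewrite mem_index_enum.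
by exists Y => //; rewrite setTI.
Qed.

Lemma measurable_fun_rVP d (T : measurableType d) (f : T -> 'rV[R]_n) :
  (forall i, measurable_fun [set: T] (fun x => f x ord0 i)) ->
  measurable_fun [set: T] f.
Proof.
move=> mf _ A mA; rewrite setTI; move: A mA.
pose G := [set A : set 'rV[R]_n | measurable (f @^-1` A)].
suff : (measurable : set (set 'rV[R]_n)) `<=` G by [].
apply: smallest_sub.
  split; rewrite /G /=.
  - by rewrite preimage_set0.
  - by move=> A mA; rewrite setTD preimage_setC; exact: measurableC.
  - by move=> F mF; rewrite preimage_bigcup; exact: bigcupT_measurable.
move=> A; rewrite -bigcup_seq/= => -[i _ [B mB <-]]; rewrite /G /= setTI.
by have := mf i measurableT B mB; rewrite setTI.
Qed.

End rV_measurable.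

Section lebesgue_rV.
Context {R : realType}.

Definition rV_cons n (p : R * 'rV[R]_n) : 'rV[R]_n.+1 :=
  row_mx (const_mx p.1 : 'rV[R]_1) p.2.

Definition rV_uncons n (x : 'rV[R]_n.+1) : R * 'rV[R]_n :=
  (x ord0 ord0, \row_i x ord0 (lift ord0 i)).

Lemma rV_unconsK n : cancel (@rV_uncons n) (@rV_cons n).
Proof.
move=> x; apply/rowP => i; rewrite mxE.
case: splitP => j ij; rewrite mxE /=.
  by congr (x _ _); apply/val_inj; rewrite /= ij (ord1 j).
by congr (x _ _); apply/val_inj; rewrite /= ij.
Qed.

Lemma rV_consK n : cancel (@rV_cons n) (@rV_uncons n).
Proof.
move=> [a x]; rewrite /rV_uncons /rV_cons; congr pair => /=.
  rewrite mxE; case: splitP => j /= ij; first by rewrite mxE.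
  by [].
apply/rowP => i; rewrite !mxE.
case: splitP => j /= ij; first by move: (ltn_ord j); rewrite -ij.
by congr (x _ _); apply/val_inj; move: ij; rewrite /bump /= !add1n => -[].
Qed.

Lemma rV_cons0 n (p : R * 'rV[R]_n) : rV_cons p ord0 ord0 = p.1.
Proof. by rewrite -{2}(rV_consK p). Qed.

Lemma rV_consS n (p : R * 'rV[R]_n) i :
  rV_cons p ord0 (lift ord0 i) = p.2 ord0 i.
Proof. by rewrite -{2}(rV_consK p) /= mxE. Qed.

Lemma measurable_rV_cons n : measurable_fun setT (@rV_cons n).
Proof.
apply: measurable_fun_rVP => i.
have [->|i0] := eqVneq i ord0.
  rewrite (_ : (fun x => _) = fst)//.
  by apply/funext => p; rewrite rV_cons0.
have [j ->] : exists j, i = lift ord0 j.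
  by case: (unliftP ord0 i) i0 => [j -> _|->]; [exists j|rewrite eqxx].
rewrite (_ : (fun x => _) = (fun x : 'rV[R]_n => x ord0 j) \o snd).
  apply: measurableT_comp; first exact: measurable_rV_coord.
  exact: measurable_snd.
by apply/funext => p; rewrite /= rV_consS.
Qed.

Lemma measurable_rV_uncons n : measurable_fun setT (@rV_uncons n).
Proof.
apply: measurable_fun_pair; first exact: measurable_rV_coord.
apply: measurable_fun_rVP => i.
rewrite (_ : (fun x => _) = (fun x : 'rV[R]_n.+1 => x ord0 (lift ord0 i))).
  exact: measurable_rV_coord.
by apply/funext => x; rewrite mxE.
Qed.

Section cons_measure.
Context n (mu : {sigma_finite_measure set 'rV[R]_n -> \bar R}).

Definition rV_cons_measure : set 'rV[R]_n.+1 -> \bar R :=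
  pushforward (@lebesgue_measure R \x mu)%E (@rV_cons n).

Let rV_cons_measure0 : rV_cons_measure set0 = 0%E.
Proof. by rewrite /rV_cons_measure /pushforward preimage_set0 measure0. Qed.

Let rV_cons_measure_ge0 A : (0 <= rV_cons_measure A)%E.
Proof. by rewrite /rV_cons_measure /pushforward; apply: measure_ge0. Qed.

Let rV_cons_measure_sigma_additive : semi_sigma_additive rV_cons_measure.
Proof.
have mpre (A : set 'rV[R]_n.+1) : measurable A -> measurable (@rV_cons n @^-1` A).
  by move=> mA; rewrite -[X in measurable X]setTI; exact: measurable_rV_cons.
move=> F mF tF mUF; rewrite /rV_cons_measure /pushforward preimage_bigcup.
apply: measure_semi_sigma_additive.
- by move=> k; exact: mpre.
- apply/trivIsetP => /= i j _ _ ij; rewrite -preimage_setI.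
  by move/trivIsetP : tF => /(_ _ _ _ _ ij) ->//; rewrite preimage_set0.
- by rewrite -preimage_bigcup; exact: mpre.
Qed.

HB.instance Definition _ := isMeasure.Build _ _ _ rV_cons_measure
  rV_cons_measure0 rV_cons_measure_ge0 rV_cons_measure_sigma_additive.

Let rV_cons_measure_sigma_finite : sigma_finite setT rV_cons_measure.
Proof.
have /sigma_finiteP[F [FT ndF Foo]] := sigma_finiteT (@lebesgue_measure R).
have /sigma_finiteP[G [GT ndG Goo]] := sigma_finiteT mu.
exists (fun k => @rV_uncons n @^-1` (F k `*` G k)).
  rewrite -preimage_bigcup (_ : \bigcup_k _ = setT) ?preimage_setT//.
  apply/seteqP; split => // -[a x] _ /=.
  have [i _ Fia] : (\bigcup_k F k) a by rewrite -FT.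
  have [j _ Gjx] : (\bigcup_k G k) x by rewrite -GT.
  exists (maxn i j) => //; split.
    by move: a Fia; exact/subsetPset/ndF/leq_maxl.
  by move: x Gjx; exact/subsetPset/ndG/leq_maxr.
move=> k; have [mF Fk] := Foo k; have [mG Gk] := Goo k; split.
  rewrite -[X in measurable X]setTI; apply: measurable_rV_uncons => //.
  exact: measurableX.
rewrite /rV_cons_measure /pushforward -comp_preimage.
rewrite (_ : _ \o _ = id); last by apply/funext => p; exact: rV_consK.
by rewrite preimage_id product_measure1E// lte_mul_pinfty// ge0_fin_numE.
Qed.

HB.instance Definition _ := Measure_isSigmaFinite.Build _ _ _
  rV_cons_measure rV_cons_measure_sigma_finite.

End cons_measure.

Fixpoint lebesgue_rV n : {sigma_finite_measure set 'rV[R]_n -> \bar R} :=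
  match n with
  | 0%N => \d_(0 : 'rV[R]_0)
  | n.+1 => rV_cons_measure (lebesgue_rV n)
  end.

End lebesgue_rV.

Lemma lebesgue_rV_box (R : realType) n (B : 'I_n -> set R) :
  (forall i, measurable (B i)) ->
  lebesgue_rV n [set x : 'rV[R]_n | forall i, B i (x ord0 i)] =
  (\prod_(i < n) @lebesgue_measure R (B i))%E.
Proof.
elim: n => [|n IHn] in B *; move=> mB.
  by rewrite big_ord0 /= diracE mem_set //=; case.
rewrite big_ord_recl /= /rV_cons_measure /pushforward.
rewrite -(IHn (fun i => B (lift ord0 i)))//.
rewrite -product_measure1E//; last first.
  rewrite (_ : [set _ | _] =
      \bigcap_(i in [set: 'I_n])
        ((fun x : 'rV[R]_n => x ord0 i) @^-1` B (lift ord0 i))).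
    apply: fin_bigcap_measurable => // i _.
    by rewrite -[X in measurable X]setTI; exact: measurable_rV_coord.
  by apply/seteqP; split => x /= Bx i; [move=> _|]; exact: Bx.
- exact: (mB ord0).
apply: (congr1 (@lebesgue_measure R \x lebesgue_rV n)%E).
apply/seteqP; split => p /=.
  move=> Bp; split=> [|i /=]; first by rewrite -rV_cons0.
  by rewrite -rV_consS.
move=> [Bp1 Bp2] i.
by have [j ->|->] := unliftP ord0 i; rewrite ?rV_cons0// rV_consS.
Qed.

(** * Complex-valued functions on R^d *)

Section symbols.
Context {R : realType}.

Definition enorm d (x : 'rV[R]_d) : R := Num.sqrt (\sum_(i < d) x ord0 i ^+ 2).

Definition cexp (z : R[i]) : R[i] :=
  (expR (Re z) * cos (Im z)) +i* (expR (Re z) * sin (Im z)).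

(** [R[i]] is not a normed module over [R] in the library, hence integrals and
    derivatives are taken on real and imaginary parts. *)

Definition cintegral (s t : R) (f : R -> R[i]) : R[i] :=
  (\int[@lebesgue_measure R]_(r in `[s, t]) Re (f r)) +i*
  (\int[@lebesgue_measure R]_(r in `[s, t]) Im (f r)).

Definition pderiv d (i : 'I_d) (f : 'rV[R]_d -> R[i]) : 'rV[R]_d -> R[i] :=
  fun x => ('D_(delta_mx ord0 i) (fun y => Re (f y)) x) +i*
           ('D_(delta_mx ord0 i) (fun y => Im (f y)) x).

Definition pderivs d (l : seq 'I_d) (f : 'rV[R]_d -> R[i]) :
    'rV[R]_d -> R[i] :=
  foldr (@pderiv d) f l.

Definition mlen d (alpha : {ffun 'I_d -> nat}) : nat := \sum_(i < d) alpha i.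

(** D^alpha = D_1^(alpha_1) ... D_d^(alpha_d), the last coordinate being
    differentiated first. *)
Definition mderiv d (alpha : {ffun 'I_d -> nat}) (f : 'rV[R]_d -> R[i]) :
    'rV[R]_d -> R[i] :=
  pderivs (flatten [seq nseq (alpha i) i | i <- enum 'I_d]) f.

(** All iterated partial derivatives of [f], of order at most [k], exist away
    from the origin (['D_v f] is total and has a default value otherwise). *)
Definition pderivable_upto d (k : nat) (f : 'rV[R]_d -> R[i]) : Prop :=
  forall (l : seq 'I_d) (i : 'I_d) (x : 'rV[R]_d),
    (size l < k)%N -> x != 0 ->
    derivable (fun y => Re (pderivs l f y)) x (delta_mx ord0 i) /\
    derivable (fun y => Im (pderivs l f y)) x (delta_mx ord0 i).

Definition is_symbol d (gamma nu : R) (psi : R -> 'rV[R]_d -> R[i]) : Prop :=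
  [/\ measurable_fun [set: R * 'rV[R]_d] (fun p => Re (psi p.1 p.2)) /\
      measurable_fun [set: R * 'rV[R]_d] (fun p => Im (psi p.1 p.2)),
      forall t xi, Re (psi t xi) <= - nu * enorm xi `^ gamma,
      forall t, pderivable_upto (d./2 + 1) (psi t) &
      forall t xi (alpha : {ffun 'I_d -> nat}),
        xi != 0 -> (mlen alpha <= d./2 + 1)%N ->
        Normc.normc (mderiv alpha (psi t) xi) <=
          nu^-1 * enorm xi `^ (gamma - (mlen alpha)%:R)].

Definition qhat d (gamma : R) (psi : R -> 'rV[R]_d -> R[i])
    (alpha : {ffun 'I_d -> nat}) (a : nat) (b s t : R) :
    'rV[R]_d -> R[i] :=
  mderiv alpha (fun xi =>
    let eta := (t - s) `^ (- gamma^-1) *: xi in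
    ((t - s)%:C * psi t eta) ^+ a * (enorm xi `^ b)%:C *
    cexp (cintegral s t (fun r => psi r eta))).

End symbols.

(* Main.v *)
Require Import Defs.
From mathcomp Require Import all_boot all_order all_algebra.
From mathcomp Require Import all_classical all_reals all_analysis.
From mathcomp Require Import complex.
From mathcomp Require Import measurable_realfun ring lra.

Set Implicit Arguments.
Unset Strict Implicit.
Unset Printing Implicit Defensive.

Import Order.TTheory GRing.Theory Num.Theory.
Import numFieldNormedType.Exports.

Local Open Scope classical_set_scope.
Local Open Scope complex_scope.
Local Open Scope ring_scope.

(** Every function involved satisfies bounds |D^beta f| <= w / |x|^|beta| off the
  origin for a weight w, and such bounds are stable under sums, products,
  dilations, integration in a parameter, and composition with exp. Since
  lam = (t - s)^(-1/gamma) satisfies (t - s) |lam x|^gamma = |x|^gamma, the weights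
  of (t - s) psi(t, lam x) and of the phase, the integral over r in [s, t] of
  psi(r, lam x), are constant multiples of |x|^gamma, uniformly in s and t. Hence
    |qhat| <= C |x|^(gamma a + b - |alpha|) (1 + |x|^gamma)^|alpha| e^(-nu |x|^gamma),
  and when a = b = 0 and alpha <> 0 at least one derivative falls on the phase,
  which improves the power of |x| to gamma - |alpha|. Squaring, what remains is a
  radial function comparable to a power of |x| near 0 and decaying fast at
  infinity, which is integrated over shells of exponentially growing radii. *)

Local Notation Re := complex.Re.
Local Notation Im := complex.Im.
Local Notation normc := Normc.normc.

(** * Integrals of radially bounded functions *)

Lemma ge0_le_integral_setT d (T : measurableType d) (R : realType)
    (mu : {measure set T -> \bar R}) (D : set T) (f g : T -> \bar R) :
  (forall x, D x -> (0 <= f x)%E) -> (forall x, (0 <= g x)%E) ->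
  (forall x, D x -> (f x <= g x)%E) ->
  (\int[mu]_(x in D) f x <= \int[mu]_x g x)%E.
Proof.
move=> f0 g0 fg; rewrite ge0_integralE// ge0_integralTE//.
apply: ub_ereal_sup => _ [h hf <-]; apply: ereal_sup_ubound.
exists h => // x; apply: le_trans (hf x) _.
by rewrite patchE; case: ifPn => // /set_mem /fg.
Qed.

Lemma lebesgue_rV_cube (R : realType) n (r : R) : 0 <= r ->
  measurable [set x : 'rV[R]_n | forall i, x ord0 i \in `[- r, r]] /\
  lebesgue_rV n [set x : 'rV[R]_n | forall i, x ord0 i \in `[- r, r]] =
    ((2 * r) ^+ n)%:E.
Proof.
move=> r0; split.
  rewrite (_ : [set _ | _] = \bigcap_(i in [set: 'I_n])
      ((fun x : 'rV[R]_n => x ord0 i) @^-1` `[- r, r])).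
    apply: fin_bigcap_measurable => // i _.
    by rewrite -[X in measurable X]setTI; exact: measurable_rV_coord.
  by apply/seteqP; split => x /= Bx i; [move=> _|]; apply: Bx.
rewrite (lebesgue_rV_box (B := fun=> `[- r, r]%classic))//.
rewrite lebesgue_measure_itv /= lte_fin.
have -> : (if (- r < r)%R then r%:E - (- r)%R%:E else 0)%E = (2 * r)%:E.
  case: ltP => h; first by rewrite -EFinB; congr EFin; ring.
  by congr EFin; lra.
by rewrite prodEFin prodr_const card_ord.
Qed.

Lemma integral_cover_le (R : realType) n (D : set 'rV[R]_n)
    (f : 'rV[R]_n -> R) (c c' r r' : nat -> R) (M M' : R) :
  (0 < n)%N -> (forall x, 0 <= f x) ->
  (forall k, 0 <= c k) -> (forall k, 0 <= c' k) ->
  (forall k, 0 <= r k) -> (forall k, 0 <= r' k) ->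
  (forall x, D x -> x != 0 -> exists k,
     (f x <= c k /\ forall i, x ord0 i \in `[- r k, r k]) \/
     (f x <= c' k /\ forall i, x ord0 i \in `[- r' k, r' k])) ->
  (forall m, \sum_(k < m) c k * (2 * r k) ^+ n <= M) ->
  (forall m, \sum_(k < m) c' k * (2 * r' k) ^+ n <= M') ->
  (\int[lebesgue_rV n]_(x in D) (f x)%:E <= (M + M')%:E)%E.
Proof.
move=> n0 f0 c0 c'0 r0 r'0 cov sM sM'.
pose B r := [set x : 'rV[R]_n | forall i, x ord0 i \in `[- r, r]].
have mB s : 0 <= s -> measurable (B s) by move=> /(lebesgue_rV_cube n)[].
have muB s : 0 <= s -> lebesgue_rV n (B s) = ((2 * s) ^+ n)%:E.
  by move=> /(lebesgue_rV_cube n)[].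
have mI s : 0 <= s ->
    measurable_fun [set: 'rV[R]_n] (fun x => (\1_(B s) x)%:E : \bar R).
  by move=> s0; apply/measurable_EFinP; apply: measurable_indic; exact: mB.
pose g (c r : nat -> R) k x : \bar R := (c k * \1_(B (r k)) x)%:E.
have g0 (u s : nat -> R) k x : (forall k, 0 <= u k) -> (0 <= g u s k x)%E.
  by move=> u0; rewrite lee_fin mulr_ge0.
have mg (u s : nat -> R) k : 0 <= s k -> measurable_fun [set: 'rV[R]_n] (g u s k).
  move=> s0; apply/measurable_EFinP/measurable_funM => //.
  by apply: measurable_indic; exact: mB.
pose G (u s : nat -> R) x : \bar R := (\sum_(0 <= k <oo) g u s k x)%E.
have mG (u s : nat -> R) : (forall k, 0 <= u k) -> (forall k, 0 <= s k) ->
    measurable_fun [set: 'rV[R]_n] (G u s).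
  move=> u0 s0; apply: ge0_emeasurable_sum => // k *; [exact: g0|exact: mg].
have G0 (u s : nat -> R) x : (forall k, 0 <= u k) -> (0 <= G u s x)%E.
  by move=> u0; apply: nneseries_ge0 => k _ _; exact: g0.
have gG (u s : nat -> R) k x : (forall k, 0 <= u k) -> (g u s k x <= G u s x)%E.
  move=> u0; have := @nneseries_lim_ge R (g u s ^~ x) xpredT 0%N k.+1
    (fun j _ _ => g0 u s j x u0).
  apply: le_trans; rewrite big_nat_recr//= leeDr//.
  by apply: sume_ge0 => j _; exact: g0.
have iG (u s : nat -> R) Q : (forall k, 0 <= u k) -> (forall k, 0 <= s k) ->
    (forall m, \sum_(k < m) u k * (2 * s k) ^+ n <= Q) ->
    (\int[lebesgue_rV n]_x G u s x <= Q%:E)%E.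
  move=> u0 s0 usQ; rewrite integral_nneseries//; last 2 first.
  - by move=> k; exact: mg.
  - by move=> k x _; exact: g0.
  apply: lime_le.
    by apply: is_cvg_nneseries => k _ _; apply: integral_ge0 => x _; exact: g0.
  apply: nearW => m; rewrite big_mkord.
  rewrite (eq_bigr (fun k : 'I_m => (u k * (2 * s k) ^+ n)%:E)).
    by rewrite sumEFin lee_fin; exact: usQ.
  move=> k _; rewrite /g.
  under eq_integral do rewrite EFinM.
  rewrite ge0_integralZl_EFin//; last exact: mI.
  rewrite integral_indic// ?setIT; last exact: mB.
  by rewrite EFinM; congr (_ * _)%E; exact: muB.
pose h x : \bar R := (f 0 * \1_(B 0) x)%:E.
have h0 x : (0 <= h x)%E by rewrite lee_fin mulr_ge0.
have mh : measurable_fun [set: 'rV[R]_n] h.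
  apply/measurable_EFinP/measurable_funM => //.
  by apply: measurable_indic; exact: mB.
have ih : (\int[lebesgue_rV n]_x h x = 0)%E.
  rewrite /h; under eq_integral do rewrite EFinM.
  rewrite ge0_integralZl_EFin//; last exact: mI.
  rewrite integral_indic// ?setIT; last exact: mB.
  rewrite [X in (_ * X)%E](_ : _ = ((2 * 0) ^+ n)%:E); last exact: muB.
  by rewrite mulr0 expr0n eqn0Ngt n0 mule0.
apply: (@le_trans _ _ (\int[lebesgue_rV n]_x (h x + (G c r x + G c' r' x)))%E).
  apply: ge0_le_integral_setT => x; first by rewrite lee_fin.
    by rewrite !adde_ge0// G0.
  move=> Dx; have [->|x0] := eqVneq x 0.
    rewrite (_ : h 0 = (f 0)%:E).
      by rewrite leeDl// adde_ge0// G0.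
    rewrite /h indicE mem_set ?mulr1// => i /=.
    by rewrite mxE in_itv/= oppr0 lexx.
  have [k [[fc xB]|[fc xB]]] := cov x Dx x0.
    apply: (@le_trans _ _ (g c r k x)).
      by rewrite /g indicE mem_set// mulr1 lee_fin.
    apply: le_trans (gG _ _ _ _ c0) _.
    by rewrite addeC -addeA leeDl// adde_ge0// G0.
  apply: (@le_trans _ _ (g c' r' k x)).
    by rewrite /g indicE mem_set// mulr1 lee_fin.
  apply: le_trans (gG _ _ _ _ c'0) _.
  by rewrite addeA leeDr// adde_ge0// G0.
rewrite ge0_integralD//; last 2 first.
- by move=> x _; rewrite adde_ge0// G0.
- by apply: emeasurable_funD; exact: mG.
rewrite ih add0e ge0_integralD//; last 4 first.
- by move=> x _; rewrite G0.
- exact: mG.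
- by move=> x _; rewrite G0.
- exact: mG.
by rewrite EFinD leeD// iG.
Qed.

Lemma sum_expX_le (R : realType) (q : R) : exists2 C : R, 0 <= C &
  (forall L : R, 0 <= L -> forall m, \sum_(k < m) (k%:R <= L)%R%:R * expR (- q) ^+ k <=
     C * (1 + expR (- (L * q)) + (q == 0)%:R * L)) /\
  (0 < q -> forall m, \sum_(k < m) expR (- q) ^+ k <= C).
Proof.
pose t k : R := expR (- q) ^+ k.
have t0 k : 0 <= t k by rewrite exprn_ge0// expR_ge0.
have le_t m (P : pred nat) : \sum_(k < m) (P k)%:R * t k <= \sum_(k < m) t k.
  by apply: ler_sum => k _; case: (P k); rewrite ?mul1r// mul0r.
have step (L B : R) : 0 <= B -> (forall m, m%:R <= L -> \sum_(k < m.+1) t k <= B) ->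
    forall m, \sum_(k < m) (k%:R <= L)%R%:R * t k <= B.
  move=> B0 HB; elim=> [|m IH]; first by rewrite big_ord0.
  have [mL|Lm] := boolP (m%:R <= L); first
    by exact: le_trans (le_t m.+1 (fun k => (k%:R <= L)%R)) (HB _ mL).
  by rewrite big_ord_recr/= (negbTE Lm) mul0r addr0.
have [q0|q0|q0] := ltgtP 0 q.
- have r1 : expR (- q) < 1 by rewrite expR_lt1 oppr_lt0.
  have d0 : 0 < 1 - expR (- q) by rewrite subr_gt0.
  have S m : \sum_(k < m) t k <= (1 - expR (- q))^-1.
    rewrite -(ler_pM2l d0) mulfV ?gt_eqF// -[X in X * _]opprB mulNr -subrX1 opprB.
    by rewrite lerBlDr lerDl exprn_ge0// expR_ge0.
  have C0 : 0 <= (1 - expR (- q))^-1 by rewrite invr_ge0 ltW.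
  exists (1 - expR (- q))^-1 => //.
  split=> // L L0 m; apply: le_trans (le_t m (fun k => (k%:R <= L)%R)) _.
  apply: le_trans (S _) _.
  by rewrite ler_peMr// -addrA lerDl mul0r addr0 expR_ge0.
- set r := expR (- q) in t t0 le_t step *.
  have r1 : 1 < r by rewrite expR_gt1 oppr_gt0.
  have d0 : 0 < r - 1 by rewrite subr_gt0.
  exists (r / (r - 1)); first by rewrite divr_ge0// ltW// (lt_trans _ r1).
  split=> // L L0 m; rewrite mul0r addr0; apply: step.
    by rewrite mulr_ge0 ?addr_ge0 ?expR_ge0// divr_ge0// ltW// (lt_trans _ r1).
  move=> k kL; rewrite -(ler_pM2l d0) -subrX1 mulrA mulrCA mulfV ?gt_eqF// mulr1.
  rewrite exprS; apply: (@le_trans _ _ (r * r ^+ k)); first by rewrite lerBlDr lerDl.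
  rewrite ler_pM2l ?(lt_trans _ r1)//.
  apply: (@le_trans _ _ (expR (- (L * q)))); last by rewrite lerDr.
  rewrite /r -expRM_natl ler_expR mulrN lerN2 ler_wnM2r// ltW//.
- subst q; exists 1 => //; split=> // L L0.
  apply: step; first by rewrite mul1r !addr_ge0 ?expR_ge0// mulr_ge0.
  move=> m mL; rewrite /t oppr0 expR0.
  under eq_bigr do rewrite expr1n.
  rewrite sumr_const card_ord mulr0 oppr0 expR0 mul1r mulr1n mul1r.
  by rewrite -natr1; lra.
Qed.

Lemma powR_expR (R : realType) (x p : R) : 0 < x -> x `^ p = expR (p * ln x).
Proof. by move=> x0; rewrite /powR gt_eqF. Qed.

Lemma abs_coord_le_enorm (R : realType) n (x : 'rV[R]_n) i : `|x ord0 i| <= enorm x.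
Proof.
rewrite -sqrtr_sqr /enorm ler_wsqrtr// (bigD1 i)//= lerDl.
by apply: sumr_ge0 => j _; rewrite sqr_ge0.
Qed.

Lemma enorm_ge0 (R : realType) n (x : 'rV[R]_n) : 0 <= enorm x.
Proof. exact: sqrtr_ge0. Qed.

Lemma enorm_gt0 (R : realType) n (x : 'rV[R]_n) : x != 0 -> 0 < enorm x.
Proof.
apply: contra_neqT; rewrite -leNgt => x0; apply/rowP => i; rewrite mxE.
apply/eqP; rewrite -normr_le0; exact: le_trans (abs_coord_le_enorm x i) x0.
Qed.

Lemma in_cube (R : realType) n (x : 'rV[R]_n) r : enorm x <= r ->
  forall i, x ord0 i \in `[- r, r].
Proof.
by move=> xr i; rewrite in_itv/= -ler_norml (le_trans (abs_coord_le_enorm x i)).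
Qed.

(* The balls of radius e^-k, resp. e^(k+1), cover the punctured unit ball,
   resp. its complement, and on the k-th shell |x| is e^-k up to a constant. *)
Lemma integral_radial_le (R : realType) n (p K : R) : (0 < n)%N -> 0 <= K ->
  exists2 N : R, 0 <= N & forall f : 'rV[R]_n -> R, (forall x, 0 <= f x) ->
    (forall x, x != 0 -> enorm x <= 1 -> f x <= K * enorm x `^ p) ->
    (forall x, 1 <= enorm x -> f x <= K * enorm x `^ (- n.+1%:R)) ->
    (forall eps : R, 0 < eps -> eps < 1 ->
      (\int[lebesgue_rV n]_(x in [set x : 'rV[R]_n | (eps <= enorm x)%R])
         (f x)%:E <=
       (N * (1 + eps `^ (p + n%:R) + (p == - n%:R)%:R * ln eps^-1))%:E)%E) /\
    (- n%:R < p -> (\int[lebesgue_rV n]_x (f x)%:E <= N%:E)%E).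
Proof.
move=> n0 K0.
have [C C0 [hC hC']] := sum_expX_le (p + n%:R).
have [C1 C10 [_ hC1]] := sum_expX_le (1 : R).
pose A := K * expR `|p| * 2 ^+ n; pose A' := K * (2 * expR 1) ^+ n.
have A0 : 0 <= A by rewrite !mulr_ge0 ?expR_ge0// exprn_ge0.
have A'0 : 0 <= A' by rewrite mulr_ge0// exprn_ge0// mulr_ge0 ?expR_ge0.
exists (A * C + A' * C1); first by rewrite addr_ge0// mulr_ge0.
move=> f f0 f1 f2.
pose c (Q : pred nat) k : R := (Q k)%:R * (K * expR `|p| * expR (- p) ^+ k).
pose r k : R := expR (- 1) ^+ k.
pose c' k : R := K * expR (- n.+1%:R) ^+ k.
pose r' k : R := expR 1 ^+ k.+1.
have c0 Q k : 0 <= c Q k by rewrite !mulr_ge0 ?exprn_ge0 ?expR_ge0.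
have c'0 k : 0 <= c' k by rewrite mulr_ge0 ?exprn_ge0 ?expR_ge0.
have r0 k : 0 <= r k by rewrite exprn_ge0 ?expR_ge0.
have r'0 k : 0 <= r' k by rewrite exprn_ge0 ?expR_ge0.
have sumc Q m : \sum_(k < m) c Q k * (2 * r k) ^+ n =
    A * \sum_(k < m) (Q k)%:R * expR (- (p + n%:R)) ^+ k.
  rewrite mulr_sumr; apply: eq_bigr => k _; rewrite /c /r /A opprD expRD.
  have -> : expR (- n%:R) = expR (- 1) ^+ n :> R by rewrite -expRM_natl mulrN1.
  rewrite !exprMn -!exprM mulnC; ring.
have sumc' m : \sum_(k < m) c' k * (2 * r' k) ^+ n <= A' * C1.
  apply: le_trans (ler_wpM2l A'0 (hC1 _ m)) => //.
  rewrite mulr_sumr; apply: ler_sum => k _; rewrite le_eqVlt; apply/orP; left.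
  apply/eqP; rewrite /c' /r' /A' -natr1 opprD expRD.
  have -> : expR (- n%:R) = (expR 1)^-1 ^+ n :> R.
    by rewrite -expRN -expRM_natl mulrN1.
  have e0 : expR 1 ^+ n ^+ k != 0 :> R by rewrite !expf_neq0// gt_eqF// expR_gt0.
  rewrite exprS !exprMn (exprAC (expR 1) k n) !exprVn.
  move: (_ ^+ k) e0 => u u0.
  by field.
have cov (Q : pred nat) (D : set 'rV[R]_n) : (forall x k, D x -> x != 0 ->
      k%:R <= - ln (enorm x) -> Q k) ->
    forall x, D x -> x != 0 -> exists k,
     (f x <= c Q k /\ forall i, x ord0 i \in `[- r k, r k]) \/
     (f x <= c' k /\ forall i, x ord0 i \in `[- r' k, r' k]).
  move=> DQ x Dx x0; have e0 := enorm_gt0 x0.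
  have [x1|x1] := leP (enorm x) 1.
    have l0 : 0 <= - ln (enorm x) by rewrite oppr_ge0 ln_le0.
    have /andP[kl lk] := truncn_itv l0.
    set k := Num.truncn (- ln (enorm x)) in kl lk.
    exists k; left; split.
      apply: le_trans (f1 _ x0 x1) _; rewrite /c (DQ _ _ Dx x0 kl) mul1r -mulrA.
      apply: ler_wpM2l => //; rewrite powR_expR// -expRM_natl -expRD ler_expR.
      rewrite -lerBlDr (le_trans (ler_norm _))//.
      rewrite (_ : _ - _ = p * (ln (enorm x) + k%:R)); last by ring.
      rewrite normrM ler_piMr// ler_norml; rewrite -natr1 in lk; apply/andP; split; lra.
    apply: in_cube; rewrite /r -expRM_natl mulrN1 -{1}(lnK e0) ler_expR; lra.
  have l0 : 0 <= ln (enorm x) by rewrite ln_ge0// ltW.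
  have /andP[kl lk] := truncn_itv l0.
  set k := Num.truncn (ln (enorm x)) in kl lk.
  exists k; right; split.
    apply: le_trans (f2 _ (ltW x1)) _; apply: ler_wpM2l => //.
    by rewrite powR_expR// -expRM_natl ler_expR mulrN mulNr lerN2 mulrC ler_wpM2l.
  by apply: in_cube; rewrite /r' -expRM_natl mulr1 -{1}(lnK e0) ler_expR ltW.
split=> [eps eps0 eps1|pn].
  have L0 : 0 <= - ln eps by rewrite oppr_ge0 ln_le0// ltW.
  set X := 1 + _ + _.
  have X1 : 1 <= X.
    rewrite /X -addrA lerDl addr_ge0 ?powR_ge0// mulr_ge0// lnV ?posrE//.
  rewrite mulrDl; apply: le_trans (integral_cover_le n0 f0 _ _ r0 r'0
    (cov (fun k => k%:R <= - ln eps) _ _) (M := A * C * X) _ sumc') _ => //.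
  - move=> x k /= ex x0 kx; apply: le_trans kx _.
    by rewrite lerN2 ler_ln// posrE// enorm_gt0.
  - move=> m; rewrite sumc -mulrA; apply: ler_wpM2l => //.
    apply: le_trans (hC _ L0 m) _; rewrite le_eqVlt; apply/orP; left; apply/eqP.
    by rewrite /X powR_expR// lnV ?posrE// addr_eq0 mulNr opprK [_ * ln eps]mulrC.
  by rewrite lee_fin lerD2l ler_peMr// mulr_ge0.
apply: (integral_cover_le n0 f0 _ _ r0 r'0 (cov xpredT _ _) _ sumc') => // m.
rewrite sumc; apply: ler_wpM2l => //.
under eq_bigr do rewrite mul1r.
by apply: hC'; rewrite addrC -ltrBlDl sub0r.
Qed.

(** * Directional derivatives of complex-valued functions *)

Section directional.
Context {R : realType} {d : nat}.
Implicit Types (i : 'I_d) (f g : 'rV[R]_d -> R[i]) (x : 'rV[R]_d).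

Local Notation ei i := (delta_mx ord0 i : 'rV[R]_d).

Definition is_cderive i f x (df : R[i]) : Prop :=
  is_derive (0 : R) (1 : R) (fun h => Re (f (x + h *: ei i))) (Re df) /\
  is_derive (0 : R) (1 : R) (fun h => Im (f (x + h *: ei i))) (Im df).

Lemma line_quotient (F : 'rV[R]_d -> R) x v :
  (fun h => h^-1 *: (F (h *: v + x) - F x)) =
  (fun h : R => h^-1 *: ((F (x + (h *: 1 + 0) *: v)) - F (x + 0 *: v))).
Proof.
apply/funext => h; rewrite scale0r !addr0 [x + _]addrC.
by rewrite [h *: 1]mulr1.
Qed.

Lemma derivable_line (F : 'rV[R]_d -> R) x v :
  derivable F x v <-> derivable (fun h : R => F (x + h *: v)) 0 1.
Proof. by rewrite /derivable line_quotient. Qed.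

Lemma derive_line (F : 'rV[R]_d -> R) x v :
  'D_v F x = 'D_1 (fun h : R => F (x + h *: v)) 0.
Proof. by rewrite /derive line_quotient. Qed.

Lemma is_cderive_pderiv i f x :
  derivable (fun y => Re (f y)) x (ei i) ->
  derivable (fun y => Im (f y)) x (ei i) -> is_cderive i f x (pderiv i f x).
Proof.
by move=> /derivable_line dr /derivable_line di; split; apply: DeriveDef => //=;
  rewrite derive_line.
Qed.

Lemma pderiv_val i f x df : is_cderive i f x df -> pderiv i f x = df.
Proof.
move=> [dr di]; rewrite /pderiv !derive_line.
rewrite (@derive_val _ _ _ _ _ _ _ dr) (@derive_val _ _ _ _ _ _ _ di).
by case: df {dr di}.
Qed.

Lemma sqr_enorm x : enorm x ^+ 2 = \sum_(j < d) x ord0 j ^+ 2.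
Proof. by rewrite sqr_sqrtr// sumr_ge0// => j _; exact: sqr_ge0. Qed.

Lemma sqr_enorm_line x i h :
  enorm (x + h *: ei i) ^+ 2 = enorm x ^+ 2 + 2 * h * x ord0 i + h ^+ 2.
Proof.
rewrite !sqr_enorm (bigD1 i)//= [in RHS](bigD1 i)//= !mxE !eqxx mulr1.
rewrite (eq_bigr (fun j => x ord0 j ^+ 2)); first ring.
by move=> j ji; rewrite !mxE (negbTE ji) andbF mulr0 addr0.
Qed.

Lemma enorm_line x i h : `|h| <= enorm x / 4 ->
  enorm x / 2 <= enorm (x + h *: ei i) <= 2 * enorm x.
Proof.
move=> hx; have x0 := enorm_ge0 x; have y0 := enorm_ge0 (x + h *: ei i).
have xi := abs_coord_le_enorm x i.
have E := sqr_enorm_line x i h.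
have H : `|h * x ord0 i| <= enorm x / 4 * enorm x by rewrite normrM ler_pM.
have H2 : `|h * h| <= enorm x / 4 * (enorm x / 4) by rewrite normrM ler_pM.
move: H H2; rewrite !ler_norml => /andP[H1 H2] /andP[H3 H4].
have hh : 0 <= h * h by rewrite -expr2 sqr_ge0.
apply/andP; split.
  rewrite -(@ler_pXn2r _ 2%N) ?nnegrE ?divr_ge0// E.
  rewrite !expr2 in E *; nra.
rewrite -(@ler_pXn2r _ 2%N) ?nnegrE ?mulr_ge0// E.
rewrite !expr2 in E *; nra.
Qed.

Lemma line_neq0 x i h : x != 0 -> `|h| <= enorm x / 4 -> x + h *: ei i != 0.
Proof.
move=> x0 /(enorm_line i)/andP[h1 _]; have := enorm_gt0 x0.
apply: contraTneq => y0; rewrite y0 in h1; rewrite -leNgt.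
suff : enorm (0 : 'rV[R]_d) = 0 by move=> e0; rewrite e0 in h1; lra.
by rewrite /enorm big1 ?sqrtr0// => j _; rewrite mxE expr0n.
Qed.

Lemma near_line_neq0 x i : x != 0 -> \forall h \near (0 : R), x + h *: ei i != 0.
Proof.
move=> x0; have e0 : 0 < enorm x / 4 by rewrite divr_gt0 ?enorm_gt0.
apply/nbhs_ballP; exists (enorm x / 4) => //= h.
by rewrite /ball/= sub0r normrN => /ltW; exact: line_neq0.
Qed.

Lemma eq_is_cderive i f g x df : x != 0 -> (forall y, y != 0 -> f y = g y) ->
  is_cderive i f x df -> is_cderive i g x df.
Proof.
move=> x0 fg [dr di]; split.
  apply: near_eq_is_derive dr; near=> h; rewrite fg//.
  by near: h; exact: near_line_neq0.
apply: near_eq_is_derive di; near=> h; rewrite fg//.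
by near: h; exact: near_line_neq0.
Unshelve. all: by end_near. Qed.

Lemma is_cderive_cst i x (c : R[i]) : is_cderive i (cst c) x 0.
Proof. by split; exact: is_derive_cst. Qed.

Lemma ReD (u v : R[i]) : Re (u + v) = Re u + Re v.
Proof. by case: u; case: v. Qed.

Lemma ImD (u v : R[i]) : Im (u + v) = Im u + Im v.
Proof. by case: u; case: v. Qed.

Lemma ReM (u v : R[i]) : Re (u * v) = Re u * Re v - Im u * Im v.
Proof. by case: u; case: v. Qed.

Lemma ImM (u v : R[i]) : Im (u * v) = Re u * Im v + Im u * Re v.
Proof. by case: u; case: v. Qed.

Lemma is_cderiveD i f g x df dg : is_cderive i f x df -> is_cderive i g x dg ->
  is_cderive i (fun y => f y + g y) x (df + dg).
Proof.
move=> [fr fi] [gr gi]; split.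
  under eq_fun do rewrite ReD.
  by rewrite ReD; exact: is_deriveD.
under eq_fun do rewrite ImD.
by rewrite ImD; exact: is_deriveD.
Qed.

Lemma is_cderiveM i f g x df dg : is_cderive i f x df -> is_cderive i g x dg ->
  is_cderive i (fun y => f y * g y) x (df * g x + f x * dg).
Proof.
move=> [fr fi] [gr gi]; split.
  under eq_fun do rewrite ReM.
  refine (is_derive_eq (is_deriveB (is_deriveM fr gr) (is_deriveM fi gi)) _).
  rewrite ReD !ReM scale0r addr0 /GRing.scale /=; ring.
under eq_fun do rewrite ImM.
refine (is_derive_eq (is_deriveD (is_deriveM fr gi) (is_deriveM fi gr)) _).
rewrite ImD !ImM scale0r addr0 /GRing.scale /=; ring.
Qed.

Lemma is_cderive_scale i f x (l : R) df : is_cderive i f (l *: x) df ->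
  is_cderive i (fun y => f (l *: y)) x (l%:C * df).
Proof.
have dl : is_derive (0 : R) (1 : R) (fun h => l * h) l.
  refine (is_derive_eq (is_deriveZ l (is_derive_id (0 : R) (1 : R))) _).
  by rewrite [LHS]mulr1.
have -> : l%:C * df = (l * Re df) +i* (l * Im df).
  by case: df => p q; apply/eqP; rewrite eq_complex/= !mul0r subr0 addr0 !eqxx.
move=> [dr di]; split => /=.
  rewrite (_ : (fun h => _) =
      (fun h => Re (f (l *: x + h *: ei i))) \o (fun h => l * h)); last first.
    by apply/funext => h /=; rewrite scalerDr scalerA.
  by rewrite mulrC; apply: is_derive1_comp; rewrite mulr0.
rewrite (_ : (fun h => _) =
    (fun h => Im (f (l *: x + h *: ei i))) \o (fun h => l * h)); last first.
  by apply/funext => h /=; rewrite scalerDr scalerA.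
by rewrite mulrC; apply: is_derive1_comp; rewrite mulr0.
Qed.

Lemma is_cderive_coord i j x :
  is_cderive i (fun y => (y ord0 j)%:C) x ((j == i)%:R%:C).
Proof.
split; last exact: is_derive_cst.
rewrite (_ : (fun h => _) = (fun h : R => x ord0 j + (j == i)%:R * h)); last first.
  by apply/funext => h /=; rewrite !mxE/= mulrC.
refine (is_derive_eq (is_deriveD (is_derive_cst (x ord0 j) (0 : R) (1 : R))
  (is_deriveZ (j == i)%:R (is_derive_id (0 : R) (1 : R)))) _).
by rewrite add0r [LHS]mulr1.
Qed.

Lemma is_cderive_enorm_powR i x (b : R) : x != 0 ->
  is_cderive i (fun y => (enorm y `^ b)%:C) x
    ((b * x ord0 i * enorm x `^ (b - 2))%:C).
Proof.
move=> x0; split; last exact: is_derive_cst.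
have e0 := enorm_gt0 x0.
have half (y : 'rV[R]_d) c : enorm y `^ c = (enorm y ^+ 2) `^ (c / 2).
  rewrite -powR_mulrn ?enorm_ge0// -powRrM; congr powR.
  by rewrite mulrCA mulfV ?mulr1// pnatr_eq0.
rewrite (_ : (fun h => _) = (fun z : R => z `^ (b / 2)) \o
    (fun h : R => enorm x ^+ 2 + ((2 * x ord0 i) * h + h * h))); last first.
  apply/funext => h /=; rewrite half sqr_enorm_line; congr powR; ring.
have Q : is_derive (0 : R) (1 : R)
    (fun h : R => enorm x ^+ 2 + ((2 * x ord0 i) * h + h * h)) (2 * x ord0 i).
  refine (is_derive_eq (is_deriveD (is_derive_cst (enorm x ^+ 2) (0 : R) (1 : R))
    (is_deriveD (is_deriveZ (2 * x ord0 i) (is_derive_id (0 : R) (1 : R)))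
      (is_deriveM (is_derive_id (0 : R) (1 : R)) (is_derive_id (0 : R) (1 : R))))) _).
  by rewrite /GRing.scale/= !mul0r !addr0 add0r mulr1.
rewrite (_ : Re _ = b / 2 * (enorm x ^+ 2) `^ (b / 2 - 1) * (2 * x ord0 i)).
  apply: is_derive1_comp; rewrite mulr0 mul0r !addr0.
  by apply: is_derive1_powR; rewrite exprn_gt0.
rewrite /= half (_ : (b - 2) / 2 = b / 2 - 1); last by field.
by field.
Qed.

Lemma is_cderive_cexp i f x df : is_cderive i f x df ->
  is_cderive i (fun y => cexp (f y)) x (df * cexp (f x)).
Proof.
move=> [dr di].
have E : is_derive (0 : R) (1 : R) (fun h => expR (Re (f (x + h *: ei i))))
    (expR (Re (f x)) * Re df).
  apply: (@is_derive1_comp _ expR) => //.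
  by rewrite scale0r addr0; exact: is_derive_expR.
have C : is_derive (0 : R) (1 : R) (fun h => cos (Im (f (x + h *: ei i))))
    (- sin (Im (f x)) * Im df).
  apply: (@is_derive1_comp _ cos) => //.
  by rewrite scale0r addr0; exact: is_derive_cos.
have S : is_derive (0 : R) (1 : R) (fun h => sin (Im (f (x + h *: ei i))))
    (cos (Im (f x)) * Im df).
  apply: (@is_derive1_comp _ sin) => //.
  by rewrite scale0r addr0; exact: is_derive_sin.
split.
  refine (is_derive_eq (is_deriveM E C) _).
  rewrite ReM/= scale0r addr0 /GRing.scale /=; ring.
refine (is_derive_eq (is_deriveM E S) _).
rewrite ImM/= scale0r addr0 /GRing.scale /=; ring.
Qed.

End directional.

(** * Symbol bounds *)

Section symbol_bound.
Context {R : realType} {d : nat}.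
Implicit Types (i : 'I_d) (l : seq 'I_d) (f g : 'rV[R]_d -> R[i]).
Implicit Types (x : 'rV[R]_d) (w : 'rV[R]_d -> R).

(* [l] lists the directions in the order in which the derivatives are taken;
   the bound is required for every sublist of [l]. *)
Fixpoint symbol_bound l f w : Prop :=
  if l is i :: l' then
    symbol_bound l' f w /\
    exists2 f', (forall x, x != 0 -> is_cderive i f x (f' x)) &
      symbol_bound l' f' (fun x => w x / enorm x)
  else forall x, x != 0 -> normc (f x) <= w x.

Lemma normc_ge0 (z : R[i]) : 0 <= normc z.
Proof. by case: z => p q; exact: sqrtr_ge0. Qed.

Lemma normcR (r : R) : normc (r%:C) = `|r|.
Proof. by rewrite /= expr0n addr0 sqrtr_sqr. Qed.

Lemma normc_cexp (z : R[i]) : normc (cexp z) = expR (Re z).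
Proof.
rewrite /= !exprMn -mulrDr cos2Dsin2 mulr1 sqrtr_sqr.
by rewrite ger0_norm// expR_ge0.
Qed.

Lemma symbol_bound_le l f w : symbol_bound l f w ->
  forall x, x != 0 -> normc (f x) <= w x.
Proof. by elim: l => //= i l IH [/IH]. Qed.

Lemma symbol_bound_ge0 l f w : symbol_bound l f w -> forall x, x != 0 -> 0 <= w x.
Proof. by move=> H x /(symbol_bound_le H); apply: le_trans; exact: normc_ge0. Qed.

Lemma symbol_boundW l f g w w' : (forall x, x != 0 -> f x = g x) ->
  (forall x, x != 0 -> w x <= w' x) -> symbol_bound l f w -> symbol_bound l g w'.
Proof.
elim: l f g w w' => [|i l IH] f g w w' fg ww' /=.
  by move=> H x x0; rewrite -fg// (le_trans (H _ x0))// ww'.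
move=> [fw [f' df f'w]]; split; first exact: IH fw.
exists f'; first by move=> x x0; apply: eq_is_cderive (df _ x0).
apply: IH f'w => // x x0.
by rewrite ler_wpM2r ?invr_ge0 ?enorm_ge0// ww'.
Qed.

Lemma symbol_bound_cst l (c : R[i]) : symbol_bound l (cst c) (cst (normc c)).
Proof.
elim: l c => //= i l IH c; split=> //.
exists (cst 0); first by move=> x _; exact: is_cderive_cst.
apply: symbol_boundW (IH 0) => // x x0; rewrite Normc.normc0.
by rewrite divr_ge0 ?normc_ge0 ?enorm_ge0.
Qed.

Lemma symbol_boundD l f g w w' : symbol_bound l f w -> symbol_bound l g w' ->
  symbol_bound l (fun x => f x + g x) (fun x => w x + w' x).
Proof.
elim: l f g w w' => [|i l IH] f g w w' /=.
  by move=> fw gw x x0; rewrite (le_trans (le_normcD _ _))// lerD ?fw ?gw.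
move=> [fw [f' df f'w]] [gw [g' dg g'w]]; split; first exact: IH.
exists (fun x => f' x + g' x).
  by move=> x x0; apply: is_cderiveD; [exact: df|exact: dg].
by apply: symbol_boundW (IH _ _ _ _ f'w g'w) => // x x0; rewrite mulrDl.
Qed.

Lemma symbol_boundM l f g w w' : symbol_bound l f w -> symbol_bound l g w' ->
  symbol_bound l (fun x => f x * g x) (fun x => 2 ^+ size l * (w x * w' x)).
Proof.
elim: l f g w w' => [|i l IH] f g w w' /=.
  move=> fw gw x x0; rewrite mul1r Normc.normcM.
  by rewrite ler_pM ?normc_ge0 ?fw ?gw.
move=> [fw [f' df f'w]] [gw [g' dg g'w]].
have w0 := symbol_bound_ge0 fw; have w'0 := symbol_bound_ge0 gw.
split.
  apply: symbol_boundW (IH _ _ _ _ fw gw) => // x x0.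
  rewrite exprS -mulrA; apply: ler_peMl; last by rewrite ler1n.
  by rewrite !mulr_ge0 ?exprn_ge0 ?w0 ?w'0.
exists (fun x => f' x * g x + f x * g' x).
  by move=> x x0; apply: is_cderiveM; [exact: df|exact: dg].
apply: symbol_boundW (symbol_boundD (IH _ _ _ _ f'w gw) (IH _ _ _ _ fw g'w)) => //.
by move=> x x0; rewrite le_eqVlt exprS; apply/orP; left; apply/eqP; ring.
Qed.

Lemma symbol_boundX l f w a : symbol_bound l f w ->
  symbol_bound l (fun x => f x ^+ a) (fun x => 2 ^+ (size l * a) * w x ^+ a).
Proof.
move=> fw; elim: a => [|a IH].
  apply: symbol_boundW (symbol_bound_cst l 1) => // x x0.
  by rewrite Normc.normc1 muln0 mulr1.
apply: symbol_boundW (symbol_boundM fw IH) => [x _|x x0]; first by rewrite exprS.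
by rewrite le_eqVlt mulnS exprD !exprS; apply/orP; left; apply/eqP; ring.
Qed.

Lemma symbol_bound_coord l j :
  symbol_bound l (fun x => (x ord0 j)%:C) (@enorm R d).
Proof.
elim: l => [|i l IH].
  by move=> x _; rewrite normcR; exact: abs_coord_le_enorm.
split=> //; exists (cst ((j == i)%:R%:C)).
  by move=> x _; exact: is_cderive_coord.
apply: symbol_boundW (symbol_bound_cst l _) => // x x0.
rewrite normcR mulfV; last by rewrite gt_eqF// enorm_gt0.
by case: (j == i); rewrite ?normr1 ?normr0.
Qed.

Lemma enorm_powRB1 x (p : R) : x != 0 -> enorm x `^ (p - 1) = enorm x `^ p / enorm x.
Proof.
move=> x0; have e0 := enorm_gt0 x0.
by rewrite !powR_expR// mulrBl mul1r expRB lnK.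
Qed.

Lemma symbol_bound_enorm_powR n (b : R) : exists2 C : R, 0 <= C &
  forall l, size l = n ->
    symbol_bound l (fun x => (enorm x `^ b)%:C) (fun x => C * enorm x `^ b).
Proof.
elim: n b => [|n IH] b.
  exists 1 => // -[]// _ x _.
  by rewrite normcR mul1r ger0_norm// powR_ge0.
have [C1 C10 H1] := IH b; have [C2 C20 H2] := IH (b - 2).
pose K := 2 ^+ n * (`|b| * (2 ^+ n * C2)).
have K0 : 0 <= K by rewrite !mulr_ge0// exprn_ge0.
exists (C1 + K); first by rewrite addr_ge0.
case=> // i l [ln]; split.
  apply: symbol_boundW (H1 _ ln) => // x x0.
  by rewrite ler_wpM2r ?powR_ge0// lerDl.
exists (fun x => (b * x ord0 i * enorm x `^ (b - 2))%:C).
  by move=> x x0; exact: is_cderive_enorm_powR.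
have := symbol_boundM (symbol_bound_cst l b%:C)
  (symbol_boundM (symbol_bound_coord l i) (H2 _ ln)).
apply: symbol_boundW => [x _|x x0]; first by rewrite /cst !rmorphM/= mulrA.
have e0 := enorm_gt0 x0.
have Eu : enorm x * enorm x `^ (b - 2) = enorm x `^ b / enorm x.
  rewrite (_ : b - 2 = b - 1 - 1); last by ring.
  by rewrite !enorm_powRB1// mulrCA mulfV ?mulr1// gt_eqF.
rewrite /cst normcR ln [enorm x * _]mulrCA Eu -[X in _ <= X]mulrA.
set u := enorm x `^ b / enorm x.
have u0 : 0 <= u by rewrite divr_ge0 ?powR_ge0 ?enorm_ge0.
have -> : 2 ^+ n * (`|b| * (2 ^+ n * (C2 * u))) = K * u by rewrite /K; ring.
by rewrite ler_wpM2r// lerDr.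
Qed.

Lemma enormZ (c : R) x : 0 <= c -> enorm (c *: x) = c * enorm x.
Proof.
move=> c0; rewrite /enorm -{2}(ger0_norm c0) -sqrtr_sqr -sqrtrM ?sqr_ge0// mulr_sumr.
by congr Num.sqrt; apply: eq_bigr => j _; rewrite mxE exprMn.
Qed.

Lemma symbol_bound_scale l f w (c : R) : 0 < c -> symbol_bound l f w ->
  symbol_bound l (fun x => f (c *: x)) (fun x => w (c *: x)).
Proof.
move=> c0; have cx x : x != 0 -> c *: x != 0.
  by move=> x0; rewrite scaler_eq0 negb_or gt_eqF.
elim: l f w => [|i l IH] f w /=; first by move=> H x /cx /H.
move=> [fw [f' df f'w]]; split; first exact: IH.
exists (fun x => c%:C * f' (c *: x)).
  by move=> x /cx x0; apply: is_cderive_scale; exact: df.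
have sub0 l0 g v : symbol_bound l0 g v ->
    symbol_bound l0 (fun x => c%:C * g x) (fun x => c * v x).
  elim: l0 g v => [|j l0 IHl0] g v /=.
    by move=> H x x0; rewrite Normc.normcM normcR gtr0_norm// ler_pM2l// H.
  move=> [gv [g' dg g'v]]; split; first exact: IHl0.
  exists (fun x => c%:C * g' x).
    move=> x x0; have := is_cderiveM (is_cderive_cst j x c%:C) (dg _ x0).
    by rewrite mul0r add0r.
  by apply: symbol_boundW (IHl0 _ _ g'v) => // x _; rewrite mulrA.
apply: symbol_boundW (sub0 _ _ _ (IH _ _ f'w)) => // x x0.
rewrite (enormZ _ (ltW c0)) le_eqVlt; apply/orP; left; apply/eqP; field.
by rewrite !gt_eqF// enorm_gt0.
Qed.

Lemma symbol_bound_cexp n (gamma K : R) : 0 <= K -> exists2 C : R, 0 <= C &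
  forall l f w, size l = n ->
    symbol_bound l f (fun x => K * enorm x `^ gamma) ->
    (forall x, x != 0 -> expR (Re (f x)) <= w x) ->
    symbol_bound l (fun x => cexp (f x))
      (fun x => C * ((1 + enorm x `^ gamma) ^+ n * w x)).
Proof.
move=> K0; elim: n => [|n [C C0 IH]].
  exists 1 => // -[]// f w _ _ fw x x0.
  by rewrite normc_cexp !mul1r; exact: fw.
exists (C + 2 ^+ n * K * C); first by rewrite addr_ge0 ?mulr_ge0 ?exprn_ge0.
case=> // i l f w [ln] [fK [f' df f'K]] fw.
have E := IH _ _ _ ln fK fw.
have w0 x : x != 0 -> 0 <= w x by move=> /fw; apply: le_trans; exact: expR_ge0.
have KC0 : 0 <= 2 ^+ n * K * C by rewrite ?mulr_ge0 ?exprn_ge0.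
split.
  apply: symbol_boundW E => // x x0.
  have a0 : 0 <= enorm x `^ gamma by exact: powR_ge0.
  apply: ler_pM => //.
  - by rewrite mulr_ge0 ?w0// exprn_ge0// addr_ge0.
  - by rewrite lerDl.
  - by rewrite ler_wpM2r ?w0// exprS ler_peMl ?exprn_ge0 ?addr_ge0// lerDl.
exists (fun x => f' x * cexp (f x)).
  by move=> x x0; apply: is_cderive_cexp; exact: df.
apply: symbol_boundW (symbol_boundM f'K E) => // x x0.
have a0 : 0 <= enorm x `^ gamma by exact: powR_ge0.
rewrite ln exprS; set q := (1 + _) ^+ n; set y := _ `^ _ in a0 *.
have q0 : 0 <= q by rewrite exprn_ge0 ?addr_ge0.
have -> : 2 ^+ n * (K * y / enorm x * (C * (q * w x))) =
  2 ^+ n * K * C * (y * q * w x) / enorm x by ring.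
rewrite ler_wpM2r ?invr_ge0 ?enorm_ge0//; apply: ler_pM => //.
- by rewrite !mulr_ge0 ?w0.
- by rewrite lerDr.
- by rewrite ler_wpM2r ?w0// ler_wpM2r// lerDr.
Qed.

Lemma pderivs_rcons l i f : pderivs (rcons l i) f = pderivs l (pderiv i f).
Proof. by rewrite /pderivs foldr_rcons. Qed.

Lemma pderivs_le l f w : symbol_bound l f w -> forall x, x != 0 ->
  normc (pderivs (rev l) f x) <= w x / enorm x ^+ size l.
Proof.
elim: l f w => [|i l IH] f w; first by move=> H x x0; rewrite divr1; exact: H.
move=> [_ [f' df f'w]] x x0.
have /IH/(_ x x0) : symbol_bound l (pderiv i f) (fun x => w x / enorm x).
  by apply: symbol_boundW f'w => // y y0; rewrite (pderiv_val (df _ y0)).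
by rewrite rev_cons pderivs_rcons /= exprS invfM mulrA.
Qed.

End symbol_bound.

(** * Symbol bounds under the integral sign *)

Section integral_segment.
Context {R : realType}.
Notation mu := (@lebesgue_measure R).
Variables (s t : R) (st : s <= t).

Lemma lebesgue_measure_segment : mu `[s, t] = (t - s)%:E.
Proof.
rewrite lebesgue_measure_itv /= lte_fin; case: ltP => ts; first by rewrite EFinB.
have -> : t = s by apply: le_anti; rewrite ts st.
by rewrite subrr.
Qed.

Lemma integrable_segment (f : R -> R) (M : R) : measurable_fun setT f ->
  (forall r, `|f r| <= M) -> mu.-integrable `[s, t] (EFin \o f).
Proof.
move=> mf fM; apply: measurable_bounded_integrable => //.
- rewrite [X in (X < _)%E](_ : _ = (t - s)%:E) ?ltry//.
  exact: lebesgue_measure_segment.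
- exact: measurable_funS mf.
- exists M; split; first exact: num_real.
  by move=> y My r _; exact: le_trans (fM r) (ltW My).
Qed.

Lemma normr_integral_segment_le (f : R -> R) (M : R) : measurable_fun setT f ->
  (forall r, `|f r| <= M) -> `|\int[mu]_(r in `[s, t]) f r| <= M * (t - s).
Proof.
move=> mf fM; have fi := integrable_segment mf fM.
apply: le_trans (le_normr_Rintegral _ fi) _ => //.
have -> : M * (t - s) = \int[mu]_(r in `[s, t]) M.
  rewrite Rintegral_cst//; congr (_ * _).
  by transitivity (fine (t - s)%:E) => //; rewrite -lebesgue_measure_segment.
apply: le_Rintegral => //.
- apply: (integrable_segment (M := M)); first exact: measurableT_comp.
  by move=> r; rewrite normr_id.
- by apply: (integrable_segment (M := `|M|)) => //; exact: measurable_cst.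
Qed.

Lemma is_derive_integral_segment (g g' : R -> R -> R) (e M M' : R) : 0 < e ->
  (forall h, `|h| < e -> measurable_fun setT (g h)) ->
  (forall h r, `|h| < e -> `|g h r| <= M') ->
  (forall h r, `|h| < e -> is_derive h (1 : R) (g ^~ r) (g' h r)) ->
  (forall h r, `|h| < e -> `|g' h r| <= M) ->
  is_derive (0 : R) (1 : R) (fun h => \int[mu]_(r in `[s, t]) g h r)
    (\int[mu]_(r in `[s, t]) g' 0 r).
Proof.
move=> e0 mg gM' dg g'M.
have Ie (h : R) : `]- e, e[%classic h -> `|h| < e.
  by rewrite /= in_itv/= -ltr_norml.
have I0 : `]- e, e[%classic (0 : R) by rewrite /= in_itv/= oppr_lt0 e0.
have intg (h : R) : `]- e, e[%classic h -> mu.-integrable `[s, t] (EFin \o g h).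
  move=> /Ie he; apply: integrable_segment; first exact: mg.
  by move=> r; exact: gM' he.
have M0 : 0 <= M by apply: le_trans (g'M 0 0 _); rewrite ?normr0.
have dv (h r : R) : `]- e, e[%classic h -> partial1of2 g h r = g' h r.
  by move=> /Ie he; rewrite partial1of2E; have [_ ->] := dg h r he.
have dd (h r : R) : `]- e, e[%classic h -> `[s, t]%classic r ->
    derivable (g ^~ r) h 1 by move=> /Ie he _; have [] := dg h r he.
have dM (h r : R) : `]- e, e[%classic h -> `[s, t]%classic r ->
    `|partial1of2 g h r| <= cst M r.
  by move=> he _; rewrite dv//; apply/g'M/Ie.
have iM : mu.-integrable `[s, t] (EFin \o cst M).
  by apply: (integrable_segment (M := `|M|)) => //; exact: measurable_cst.
apply: DeriveDef; first exact: (derivable_under_integral _ I0 intg dd _ iM dM).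
rewrite -derive1E (differentiation_under_integral _ I0 intg dd _ iM dM)//.
by apply: eq_Rintegral => r _; rewrite dv.
Qed.

End integral_segment.

Section symbol_bound_integral.
Context {R : realType} {d : nat}.
Implicit Types (i : 'I_d) (l : seq 'I_d).

Lemma powR_between (a b y p : R) : 0 < a -> a <= y -> y <= b ->
  y `^ p <= a `^ p + b `^ p.
Proof.
move=> a0 ay yb; have y0 := lt_le_trans a0 ay; have b0 := lt_le_trans y0 yb.
have [p0|p0] := leP 0 p.
  by apply: ler_wpDl; rewrite ?powR_ge0// ge0_ler_powR// nnegrE ltW.
apply: ler_wpDr; rewrite ?powR_ge0// !powR_expR// ler_expR.
by rewrite ler_nM2l// ler_ln.
Qed.

Lemma le_Re_normc (z : R[i]) : `|Re z| <= normc z.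
Proof. by case: z => p q /=; rewrite -sqrtr_sqr ler_wsqrtr// lerDl sqr_ge0. Qed.

Lemma le_Im_normc (z : R[i]) : `|Im z| <= normc z.
Proof. by case: z => p q /=; rewrite -sqrtr_sqr ler_wsqrtr// lerDr sqr_ge0. Qed.

Lemma normc_le (z : R[i]) : normc z <= `|Re z| + `|Im z|.
Proof.
case: z => p q /=; rewrite -[X in _ <= X]ger0_norm ?addr_ge0// -sqrtr_sqr.
rewrite ler_wsqrtr// sqrrD !real_normK ?num_real//.
by rewrite lerD2r lerDl mulrn_wge0// mulr_ge0.
Qed.

Lemma measurable_derive (g : R -> R -> R) (g' : R -> R) :
  (forall h, measurable_fun setT (g h)) ->
  (forall r, is_derive (0 : R) (1 : R) (g ^~ r) (g' r)) ->
  measurable_fun setT g'.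
Proof.
move=> mg dg.
pose q (n : nat) r := (n.+1%:R : R) * (g (n.+1%:R^-1) r - g 0 r).
apply: (measurable_fun_cvg (h := q)).
  move=> n; apply: measurable_funM => //.
  by apply: measurable_funB; exact: mg.
move=> r _; have [dr <-] := dg r.
have hn0 : (forall n : nat, (n.+1%:R^-1 : R) != 0) /\ (n.+1%:R^-1 : R) @[n --> \oo] --> 0.
  split; first by move=> n; rewrite invr_eq0 pnatr_eq0.
  exact: cvg_harmonic.
have /cvg_ex[/= l fl] := dr.
have -> : 'D_1 (g ^~ r) 0 = l by apply/cvg_lim.
move: fl => /cvgr_dnbhsP/(_ _ hn0).
apply: cvg_trans; apply: near_eq_cvg; apply: nearW => n.
by rewrite /q invrK [_ *: 1]mulr1 addr0.
Qed.

Lemma symbol_bound_cintegral (s t : R) : s <= t -> forall l (C p : R)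
    (F : R -> 'rV[R]_d -> R[i]), 0 <= C ->
  (forall r, symbol_bound l (F r) (fun x => C * enorm x `^ p)) ->
  (forall x, measurable_fun setT (fun r => Re (F r x))) ->
  (forall x, measurable_fun setT (fun r => Im (F r x))) ->
  symbol_bound l (fun x => cintegral s t (F ^~ x))
    (fun x => 2 * (t - s) * C * enorm x `^ p).
Proof.
move=> st; elim=> [|i l IH] C p F C0 FC mR mI.
  move=> x x0; apply: le_trans (normc_le _) _.
  have bR r : `|Re (F r x)| <= C * enorm x `^ p.
    by apply: le_trans (le_Re_normc _) _; exact: FC.
  have bI r : `|Im (F r x)| <= C * enorm x `^ p.
    by apply: le_trans (le_Im_normc _) _; exact: FC.
  have := lerD (normr_integral_segment_le st (mR x) bR)
    (normr_integral_segment_le st (mI x) bI).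
  move=> /le_trans; apply; rewrite le_eqVlt; apply/orP; left; apply/eqP; ring.
split; first by apply: IH => // r; have [] := FC r.
have /choice[F1 HF1] : forall r, exists f',
    (forall x, x != 0 -> is_cderive i (F r) x (f' x)) /\
    symbol_bound l f' (fun x => C * enorm x `^ p / enorm x).
  by move=> r; have [_ [f' ? ?]] := FC r; exists f'.
pose F' r x := if x == 0 then 0 else F1 r x.
have F'C r : symbol_bound l (F' r) (fun x => C * enorm x `^ (p - 1)).
  apply: symbol_boundW (HF1 r).2 => x x0; first by rewrite /F' (negbTE x0).
  by rewrite enorm_powRB1// mulrA.
have dF r x : x != 0 -> is_cderive i (F r) x (F' r x).
  by move=> x0; rewrite /F' (negbTE x0); exact: (HF1 r).1.
have mR' x : measurable_fun setT (fun r => Re (F' r x)).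
  have [->|x0] := eqVneq x 0.
    by rewrite /F' eqxx; exact: measurable_cst.
  by apply: (measurable_derive (g := fun h r => Re (F r (x + h *: delta_mx ord0 i))));
    [move=> h; exact: mR|move=> r; exact: (dF r x x0).1].
have mI' x : measurable_fun setT (fun r => Im (F' r x)).
  have [->|x0] := eqVneq x 0.
    by rewrite /F' eqxx; exact: measurable_cst.
  by apply: (measurable_derive (g := fun h r => Im (F r (x + h *: delta_mx ord0 i))));
    [move=> h; exact: mI|move=> r; exact: (dF r x x0).2].
exists (fun x => cintegral s t (F' ^~ x)); last first.
  apply: symbol_boundW (IH C (p - 1) F' C0 F'C mR' mI') => // x x0.
  by rewrite enorm_powRB1// mulrA.
move=> x x0; have e0 := enorm_gt0 x0.
pose M q := C * ((enorm x / 2) `^ q + (2 * enorm x) `^ q).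
have bnd q (G : R -> 'rV[R]_d -> R[i]) h r : `|h| < enorm x / 4 ->
    symbol_bound [::] (G r) (fun x => C * enorm x `^ q) ->
    normc (G r (x + h *: delta_mx ord0 i)) <= M q.
  move=> /ltW he GC; apply: le_trans (GC _ (line_neq0 i x0 he)) _.
  have /andP[h1 h2] := enorm_line i he.
  by rewrite ler_wpM2l// powR_between// divr_gt0.
have FB h r he := bnd p F h r he (symbol_bound_le (FC r)).
have F'B h r he := bnd (p - 1) F' h r he (symbol_bound_le (F'C r)).
have shift (f : 'rV[R]_d -> R) h df :
    is_derive (0 : R) (1 : R)
      (fun u => f (x + h *: delta_mx ord0 i + u *: delta_mx ord0 i)) df ->
    is_derive h (1 : R) (fun u => f (x + u *: delta_mx ord0 i)) df.
  move=> fd.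
  rewrite (_ : (fun u => _) =
    (fun u => f (x + h *: delta_mx ord0 i + u *: delta_mx ord0 i)) \o
    (shift (- h))); last first.
    apply/funext => u /=; rewrite -addrA -scalerDl; congr (f (x + _ *: _)); ring.
  rewrite -[df]mulr1; apply: is_derive1_comp; last exact: is_derive_shift.
  by rewrite /= subrr.
have e4 : 0 < enorm x / 4 by rewrite divr_gt0.
have x00 : x = x + 0 *: delta_mx ord0 i by rewrite scale0r addr0.
split.
  rewrite /= {2}x00.
  apply: (is_derive_integral_segment (g := fun h r => Re (F r (x + h *: delta_mx ord0 i)))
    (g' := fun h r => Re (F' r (x + h *: delta_mx ord0 i)))
    (M := M (p - 1)) (M' := M p) st e4) => [h _|h r he|h r he|h r he].
  - exact: mR.
  - by apply: le_trans (le_Re_normc _) _; exact: FB.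
  - apply: (shift (fun y => Re (F r y))).
    exact: (dF r _ (line_neq0 i x0 (ltW he))).1.
  - by apply: le_trans (le_Re_normc _) _; exact: F'B.
rewrite /= {2}x00.
apply: (is_derive_integral_segment (g := fun h r => Im (F r (x + h *: delta_mx ord0 i)))
  (g' := fun h r => Im (F' r (x + h *: delta_mx ord0 i)))
  (M := M (p - 1)) (M' := M p) st e4) => [h _|h r he|h r he|h r he].
- exact: mI.
- by apply: le_trans (le_Im_normc _) _; exact: FB.
- apply: (shift (fun y => Im (F r y))).
  exact: (dF r _ (line_neq0 i x0 (ltW he))).2.
- by apply: le_trans (le_Im_normc _) _; exact: F'B.
Qed.

End symbol_bound_integral.

(** * Pointwise bounds on qhat *)

Section multi_index.
Context {R : realType} {d : nat}.
Implicit Types (l : seq 'I_d) (alpha : {ffun 'I_d -> nat}).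

Definition index_seq alpha : seq 'I_d :=
  flatten [seq nseq (alpha i) i | i <- enum 'I_d].

Let leI : rel 'I_d := fun i j => (i <= j)%N.

Lemma size_index_seq alpha : size (index_seq alpha) = mlen alpha.
Proof.
rewrite size_flatten sumnE /shape -map_comp big_map big_enum /=.
by apply: eq_bigr => i _; rewrite size_nseq.
Qed.

Lemma count_index_seq alpha i : count_mem i (index_seq alpha) = alpha i.
Proof.
rewrite count_flatten sumnE -map_comp big_map big_enum /= (bigD1 i)//= big1.
  by rewrite count_nseq /= eqxx mul1n addn0.
by move=> j ji; rewrite count_nseq /= (negbTE ji).
Qed.

Lemma sorted_index_seq alpha : sorted leI (index_seq alpha).
Proof.
have tr : transitive leI by move=> i j k; exact: leq_trans.
rewrite sorted_pairwise// /index_seq.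
have : pairwise leI (enum 'I_d).
  rewrite -sorted_pairwise//.
  have : sorted leq [seq val i | i <- enum 'I_d].
    by rewrite val_enum_ord iota_sorted.
  by rewrite sorted_map.
elim: (enum 'I_d) => //= i s IH /andP[/allP is_ /IH {}IH].
rewrite pairwise_cat IH andbT; apply/andP; split.
  apply/allrelP => j k /nseqP[-> _] /flatten_mapP[m ms /nseqP[-> _]].
  exact: is_.
by elim: (alpha i) => //= n ->; rewrite all_nseq /leI leqnn orbT.
Qed.

Lemma pderivs_sorted l (f : 'rV[R]_d -> R[i]) : sorted leI l ->
  mlen [ffun i => count_mem i l] = size l /\
  pderivs l f = mderiv [ffun i => count_mem i l] f.
Proof.
move=> sl; set alpha := [ffun i => _].
suff El : l = index_seq alpha by rewrite {1 2}El size_index_seq.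
apply: (@sorted_eq _ leI) => //.
- by move=> i j k; exact: leq_trans.
- by move=> i j; rewrite /leI -eqn_leq => /eqP/val_inj.
- exact: sorted_index_seq.
- by apply/allP => i _; apply/eqP; rewrite /= count_index_seq ffunE.
Qed.

Lemma symbol_bound_pderivs k (f : 'rV[R]_d -> R[i]) (C p : R) :
  pderivable_upto k f ->
  (forall x alpha, x != 0 -> (mlen alpha <= k)%N ->
    normc (mderiv alpha f x) <= C * enorm x `^ (p - (mlen alpha)%:R)) ->
  forall l l0, sorted leI (rev l ++ l0) -> (size l + size l0 <= k)%N ->
  symbol_bound l (pderivs l0 f) (fun x => C * enorm x `^ (p - (size l0)%:R)).
Proof.
move=> df fC; have tr : transitive leI by move=> i j m; exact: leq_trans.
elim=> [|i l IH] l0 sl lk.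
  move=> x x0; have [ml ->] := pderivs_sorted f sl.
  by rewrite -ml; apply: fC; rewrite // ml.
split.
  apply: IH; last by rewrite (leq_trans _ lk)// leq_add2r /=.
  apply: subseq_sorted sl => //; rewrite cat_subseq// rev_cons.
  exact: subseq_rcons.
exists (pderivs (i :: l0) f).
  move=> x x0; apply: is_cderive_pderiv.
    by have [] := df l0 i x _ x0; rewrite // (leq_trans _ lk)//= ltnS leq_addl.
  by have [] := df l0 i x _ x0; rewrite // (leq_trans _ lk)//= ltnS leq_addl.
have := IH (i :: l0); rewrite -cat_rcons -rev_cons /= addnS.
move=> /(_ sl lk); apply: symbol_boundW => // x x0.
by rewrite -natr1 opprD addrA enorm_powRB1// mulrA.
Qed.

End multi_index.

Section qhat_bound.
Context {R : realType} {d : nat}.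
Variables (gamma nu : R) (hgamma : 0 < gamma) (hnu : 0 < nu).
Variables (psi : R -> 'rV[R]_d -> R[i]) (hpsi : is_symbol gamma nu psi).
Variables (s t : R) (st : s < t).

Local Notation lam := ((t - s) `^ (- gamma^-1)).
Local Notation phase := (fun xi => cintegral s t (fun r => psi r (lam *: xi))).

Lemma scale_gt0 : 0 < lam.
Proof. by rewrite powR_gt0// subr_gt0. Qed.

Lemma enorm_scale_powR (x : 'rV[R]_d) :
  (t - s) * enorm (lam *: x) `^ gamma = enorm x `^ gamma.
Proof.
have ts0 : 0 < t - s by rewrite subr_gt0.
rewrite enormZ ?powR_ge0// powRM ?powR_ge0 ?enorm_ge0// -powRrM mulNr mulVf ?gt_eqF//.
by rewrite powR_inv1 ?ltW// mulrA mulfV ?mul1r// gt_eqF.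
Qed.

Lemma symbol_bound_psi alpha r : (mlen alpha <= d./2 + 1)%N ->
  symbol_bound (rev (index_seq alpha)) (psi r)
    (fun x => nu^-1 * enorm x `^ gamma).
Proof.
move=> ak; have [_ _ dpsi bpsi] := hpsi.
have := @symbol_bound_pderivs _ _ _ (psi r) nu^-1 gamma (dpsi r)
  (fun x beta => bpsi r x beta) (rev (index_seq alpha)) [::].
rewrite cats0 revK size_rev size_index_seq addn0 => /(_ (sorted_index_seq _) ak).
by apply: symbol_boundW => // x _; rewrite subr0.
Qed.

Lemma symbol_bound_scaled_psi alpha : (mlen alpha <= d./2 + 1)%N ->
  symbol_bound (rev (index_seq alpha)) (fun x => (t - s)%:C * psi t (lam *: x))
    (fun x => 2 ^+ mlen alpha * nu^-1 * enorm x `^ gamma).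
Proof.
move=> ak; have ts0 : 0 < t - s by rewrite subr_gt0.
have := symbol_boundM (symbol_bound_cst (rev (index_seq alpha)) (t - s)%:C)
  (symbol_bound_scale scale_gt0 (symbol_bound_psi t ak)).
apply: symbol_boundW => // x x0.
rewrite /cst normcR gtr0_norm// size_rev size_index_seq -(enorm_scale_powR x).
by rewrite le_eqVlt; apply/orP; left; apply/eqP; ring.
Qed.

Lemma measurable_psi (x : 'rV[R]_d) :
  measurable_fun setT (fun r => Re (psi r x)) /\
  measurable_fun setT (fun r => Im (psi r x)).
Proof.
have [[mR mI] _ _ _] := hpsi.
by split; [exact: (measurable_fun_pair1 x mR)|exact: (measurable_fun_pair1 x mI)].
Qed.

Lemma symbol_bound_phase alpha : (mlen alpha <= d./2 + 1)%N ->
  symbol_bound (rev (index_seq alpha)) phase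
    (fun x => 2 * nu^-1 * enorm x `^ gamma).
Proof.
move=> ak; have nu0 : 0 <= nu^-1 by rewrite invr_ge0 ltW.
have := symbol_bound_scale scale_gt0 (symbol_bound_cintegral (ltW st) nu0
  (fun r => symbol_bound_psi r ak)
  (fun x => (measurable_psi x).1) (fun x => (measurable_psi x).2)).
apply: symbol_boundW => // x x0.
rewrite -(enorm_scale_powR x).
by rewrite le_eqVlt; apply/orP; left; apply/eqP; ring.
Qed.

Lemma Re_phase_le x : x != 0 -> Re (phase x) <= - nu * enorm x `^ gamma.
Proof.
move=> x0; have [_ rpsi _ _] := hpsi.
have y0 : lam *: x != 0 by rewrite scaler_eq0 negb_or gt_eqF ?scale_gt0.
set y := lam *: x in y0 *.
have b0 : (mlen ([ffun=> 0%N] : {ffun 'I_d -> nat}) <= d./2 + 1)%N.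
  by rewrite /mlen; under eq_bigr do rewrite ffunE; rewrite big1_eq.
have yM r : `|Re (psi r y)| <= nu^-1 * enorm y `^ gamma.
  apply: le_trans (le_Re_normc _) _.
  exact: (symbol_bound_le (symbol_bound_psi r b0)).
have [mR _] := measurable_psi y.
have -> : - nu * enorm x `^ gamma =
    \int[lebesgue_measure]_(r in `[s, t]) (- nu * enorm y `^ gamma).
  rewrite Rintegral_cst//.
  have -> : fine (lebesgue_measure (`[s, t]%classic : set R)) = t - s.
    by rewrite (lebesgue_measure_segment (ltW st)).
  by rewrite -(enorm_scale_powR x) /y; ring.
apply: le_Rintegral => //.
- exact: (integrable_segment (ltW st) mR yM).
- by apply: (integrable_segment (M := `|- nu * enorm y `^ gamma|) (ltW st)).
Qed.

Lemma enorm_powRBn (x : 'rV[R]_d) (p : R) n : x != 0 ->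
  enorm x `^ (p - n%:R) = enorm x `^ p / enorm x ^+ n.
Proof.
move=> x0; elim: n => [|n IH]; first by rewrite subr0 divr1.
by rewrite -natr1 opprD addrA enorm_powRB1// IH exprSr invfM mulrA.
Qed.

End qhat_bound.

Lemma qhat_le (R : realType) (d : nat) (gamma nu : R) (a n : nat) (b : R) :
  0 < gamma -> 0 < nu -> exists2 C : R, 0 <= C &
  forall (psi : R -> 'rV[R]_d -> R[i]) (alpha : {ffun 'I_d -> nat}),
    is_symbol gamma nu psi -> (mlen alpha <= d./2 + 1)%N -> mlen alpha = n ->
  forall (s t : R) x, s < t -> x != 0 ->
    normc (qhat gamma psi alpha a b s t x) <=
    C * (enorm x `^ (gamma * a%:R + b - n%:R) *
      ((1 + enorm x `^ gamma) ^+ n * expR (- nu * enorm x `^ gamma))).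
Proof.
move=> hgamma hnu; have nu0 : 0 <= nu^-1 by rewrite invr_ge0 ltW.
have [C2 C20 H2] := @symbol_bound_enorm_powR R d n b.
have K0 : 0 <= 2 * nu^-1 by rewrite mulr_ge0.
have [C3 C30 H3] := @symbol_bound_cexp R d n gamma _ K0.
pose C := 2 ^+ n * (2 ^+ n * (2 ^+ (n * a) * (2 ^+ n * nu^-1) ^+ a * C2) * C3).
exists C; first by rewrite !mulr_ge0 ?exprn_ge0// mulr_ge0 ?exprn_ge0.
move=> psi alpha hpsi ak an s t x st x0.
have szn : size (rev (index_seq alpha)) = n by rewrite size_rev size_index_seq.
have B1 := symbol_boundX a (symbol_bound_scaled_psi hgamma hpsi st ak).
have B2 := H2 _ szn.
pose Phi y := cintegral s t (fun r => psi r ((t - s) `^ (- gamma^-1) *: y)).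
have RePhi y : y != 0 -> expR (Re (Phi y)) <= expR (- nu * enorm y `^ gamma).
  by move=> y0; rewrite ler_expR; exact: (Re_phase_le hgamma hpsi st).
have B3 := H3 _ _ _ szn (symbol_bound_phase hgamma hnu hpsi st ak) RePhi.
have := pderivs_le (symbol_boundM (symbol_boundM B1 B2) B3) x0.
rewrite revK /qhat /mderiv => /le_trans; apply.
rewrite enorm_powRBn// szn an powRD; last by rewrite (gt_eqF (enorm_gt0 x0)) implybT.
rewrite powRrM powR_mulrn ?powR_ge0// le_eqVlt; apply/orP; left; apply/eqP.
by rewrite /C !exprMn; ring.
Qed.

(* Without the polynomial prefactors the derivative must hit the exponential,
   which gains a factor |x|^gamma near the origin. *)
Lemma qhat_exp_le (R : realType) (d : nat) (gamma nu : R) (n : nat) :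
  0 < gamma -> 0 < nu -> exists2 C : R, 0 <= C &
  forall (psi : R -> 'rV[R]_d -> R[i]) (alpha : {ffun 'I_d -> nat}),
    is_symbol gamma nu psi -> (mlen alpha <= d./2 + 1)%N -> mlen alpha = n.+1 ->
  forall (s t : R) x, s < t -> x != 0 ->
    normc (qhat gamma psi alpha 0 0 s t x) <=
    C * (enorm x `^ (gamma - n.+1%:R) *
      ((1 + enorm x `^ gamma) ^+ n.+1 * expR (- nu * enorm x `^ gamma))).
Proof.
move=> hgamma hnu; have nu0 : 0 <= nu^-1 by rewrite invr_ge0 ltW.
have K0 : 0 <= 2 * nu^-1 by rewrite mulr_ge0.
have [C3 C30 H3] := @symbol_bound_cexp R d n gamma _ K0.
pose C := 2 ^+ n * (2 * nu^-1 * C3).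
have C0 : 0 <= C by rewrite !mulr_ge0 ?exprn_ge0.
exists C => // psi alpha hpsi ak an s t x st x0.
rewrite /qhat /mderiv -/(index_seq alpha) -[index_seq alpha]revK.
set F := (fun xi => _).
pose Phi y := cintegral s t (fun r => psi r ((t - s) `^ (- gamma^-1) *: y)).
have -> : F = fun y => cexp (Phi y).
  by apply/funext => y; rewrite /F expr0 mul1r powRr0 mul1r.
have szn : size (rev (index_seq alpha)) = n.+1 by rewrite size_rev size_index_seq.
have B := symbol_bound_phase hgamma hnu hpsi st ak.
have RePhi y : y != 0 -> expR (Re (Phi y)) <= expR (- nu * enorm y `^ gamma).
  by move=> y0; rewrite ler_expR; exact: (Re_phase_le hgamma hpsi st).
move: B szn; case: (rev _) => // i l [B [f' df f'B]] [ln].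
have := symbol_boundM f'B (H3 _ _ _ ln B RePhi).
rewrite ln => B'.
have {}B' : symbol_bound l (pderiv i (fun y => cexp (Phi y)))
    (fun y => C * (enorm y `^ gamma * ((1 + enorm y `^ gamma) ^+ n *
      expR (- nu * enorm y `^ gamma)) / enorm y)).
  apply: symbol_boundW B' => y y0.
    by rewrite (pderiv_val (is_cderive_cexp (df _ y0))).
  by rewrite le_eqVlt; apply/orP; left; apply/eqP; rewrite /C; ring.
rewrite rev_cons pderivs_rcons; apply: le_trans (pderivs_le B' x0) _.
rewrite ln enorm_powRBn// [enorm x ^+ _.+1]exprS invfM.
set y := enorm x `^ gamma; set e := expR _.
have y0 : 0 <= y by exact: powR_ge0.
have e0 : 0 <= e by exact: expR_ge0.
have u0 : 0 <= (1 + y) ^+ n by rewrite exprn_ge0// addr_ge0.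
clearbody C; rewrite -!mulrA; apply: ler_wpM2l => //.
rewrite [X in _ <= X](_ : _ = y * ((1 + y) ^+ n.+1 * e *
  ((enorm x)^-1 * (enorm x ^+ n)^-1))); last by ring.
rewrite [X in X <= _](_ : _ = y * ((1 + y) ^+ n * e *
  ((enorm x)^-1 * (enorm x ^+ n)^-1))); last by ring.
apply: ler_wpM2l => //; apply: ler_wpM2r.
  by rewrite mulr_ge0 ?invr_ge0 ?exprn_ge0 ?enorm_ge0.
by apply: ler_wpM2r => //; rewrite exprS ler_peMl// lerDl.
Qed.

(** * Integral bounds on qhat *)

Lemma powR_expR_bounded (R : realType) (gamma nu p : R) : 0 < gamma -> 0 < nu ->
  exists2 K : R, 0 <= K &
    forall r, 1 <= r -> r `^ p * expR (- nu * r `^ gamma) <= K.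
Proof.
move=> g0 n0; set m := (Num.truncn (`|p| / gamma)).+1.
have pm : p <= gamma * m%:R.
  have /andP[_ /ltW] := truncn_itv (divr_ge0 (normr_ge0 p) (ltW g0)).
  rewrite -/m ler_pdivrMr// mulrC; apply: le_trans; exact: ler_norm.
exists ((m%:R / nu) ^+ m); first by rewrite exprn_ge0// divr_ge0// ltW.
move=> r r1; have r0 : 0 < r := lt_le_trans ltr01 r1.
have m0 : 0 < m%:R :> R by rewrite ltr0n.
set y := r `^ gamma; have y0 : 0 < y by exact: powR_gt0.
apply: (@le_trans _ _ (y ^+ m * expR (- nu * y))).
  rewrite ler_wpM2r ?expR_ge0// -powR_mulrn ?(ltW y0)// -powRrM.
  by rewrite !powR_expR// ler_expR ler_wpM2r// ln_ge0.
have q0 : 0 < nu * y / m%:R by rewrite divr_gt0// mulr_gt0.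
have E : (nu * y / m%:R) ^+ m <= expR (nu * y).
  rewrite -[X in expR X](@mulfVK _ m%:R) ?gt_eqF// [_ * m%:R]mulrC expRM_natl.
  rewrite lerXn2r ?nnegrE ?expR_ge0 ?(ltW q0)//.
  by apply: le_trans (expR_ge1Dx _); rewrite lerDr.
rewrite mulNr expRN -[_ * _^-1]/(_ / _) ler_pdivrMr ?expR_gt0//.
apply: le_trans (ler_wpM2l _ E); last by rewrite exprn_ge0// divr_ge0// ltW.
rewrite -exprMn le_eqVlt; apply/orP; left; apply/eqP; congr (_ ^+ _).
by field; rewrite !gt_eqF.
Qed.

Lemma uniform_constant (R : realType) (P : nat -> R -> Prop) :
  (forall n N N', N <= N' -> P n N -> P n N') ->
  (forall n, exists2 N, 0 <= N & P n N) ->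
  forall k, exists2 N, 0 <= N & forall n, (n <= k)%N -> P n N.
Proof.
move=> mP eP; elim=> [|k [N N0 HN]].
  by have [N N0 HN] := eP 0%N; exists N => // n; rewrite leqn0 => /eqP ->.
have [N' N'0 HN'] := eP k.+1; exists (N + N'); first exact: addr_ge0.
move=> n; rewrite leq_eqVlt => /predU1P[->|/HN].
  by apply: mP HN'; rewrite lerDr.
by apply: mP; rewrite lerDl.
Qed.

Section integral_bound.
Context {R : realType} {d : nat}.
Variables (gamma nu : R) (a : nat) (b : R).
Hypotheses (hd : (0 < d)%N) (hgamma : 0 < gamma) (hnu : 0 < nu).

(* The exponent of |x| near the origin in the bound on qhat. *)
Let order n : R :=
  if [&& a == 0%N, b == 0 & n != 0%N] then gamma - n%:R
  else gamma * a%:R + b - n%:R.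

Let qhat_pointwise n : exists2 C : R, 0 <= C &
  forall (psi : R -> 'rV[R]_d -> R[i]) (alpha : {ffun 'I_d -> nat}),
    is_symbol gamma nu psi -> (mlen alpha <= d./2 + 1)%N -> mlen alpha = n ->
  forall (s t : R) x, s < t -> x != 0 ->
    normc (qhat gamma psi alpha a b s t x) <=
    C * (enorm x `^ order n *
      ((1 + enorm x `^ gamma) ^+ n * expR (- nu * enorm x `^ gamma))).
Proof.
rewrite /order; case: ifPn => [/and3P[/eqP -> /eqP -> ]|_]; last exact: qhat_le.
by case: n => // n _; exact: qhat_exp_le.
Qed.

Let bound n (N : R) := forall (psi : R -> 'rV[R]_d -> R[i])
    (alpha : {ffun 'I_d -> nat}),
  is_symbol gamma nu psi -> (mlen alpha <= d./2 + 1)%N -> mlen alpha = n ->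
  let e := 2 * order n in
  (forall eps s t : R, 0 < eps -> eps < 1 -> s < t ->
    (\int[lebesgue_rV d]_(xi in [set xi : 'rV[R]_d | (eps <= enorm xi)%R])
       (normc (qhat gamma psi alpha a b s t xi) ^+ 2)%:E <=
     (N * (1 + eps `^ (e + d%:R) + (e == - d%:R)%:R * ln eps^-1))%:E)%E) /\
  (- d%:R < e -> forall s t : R, s < t ->
    (\int[lebesgue_rV d]_xi (normc (qhat gamma psi alpha a b s t xi) ^+ 2)%:E <=
      N%:E)%E).

Lemma weight_ge1 (e eps : R) : eps < 1 -> 0 < eps ->
  1 <= 1 + eps `^ (e + d%:R) + (e == - d%:R)%:R * ln eps^-1.
Proof.
move=> eps1 eps0; rewrite -addrA lerDl addr_ge0 ?powR_ge0// mulr_ge0//.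
by rewrite lnV ?posrE// oppr_ge0 ln_le0// ltW.
Qed.

Let boundW n N N' : N <= N' -> bound n N -> bound n N'.
Proof.
move=> NN' H psi alpha hpsi ak an e; have [H1 H2] := H psi alpha hpsi ak an.
split=> [eps s t eps0 eps1 st|ed s t st].
  apply: le_trans (H1 _ _ _ eps0 eps1 st) _; rewrite lee_fin ler_wpM2r//.
  by rewrite (le_trans ler01)// weight_ge1.
by apply: le_trans (H2 ed _ _ st) _; rewrite lee_fin.
Qed.

Let bound_exists n : exists2 N, 0 <= N & bound n N.
Proof.
have [C C0 HC] := qhat_pointwise n.
pose e := 2 * order n.
have [K K0 HK] := @powR_expR_bounded R gamma (2 * nu)
  (e + gamma * (2 * n)%:R + d.+1%:R) hgamma (mulr_gt0 (ltr0Sn _ _) hnu).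
pose A := C ^+ 2 * (4 ^+ n * (1 + K)).
have A0 : 0 <= A by rewrite !mulr_ge0 ?exprn_ge0// addr_ge0.
have [N N0 HN] := integral_radial_le e hd A0.
exists N => // psi alpha hpsi ak an e'.
have one : 1 `^ gamma = 1 :> R by rewrite powR1.
have B (s t : R) (st : s < t) := HN
  (fun xi => normc (qhat gamma psi alpha a b s t xi) ^+ 2)
  (fun xi => sqr_ge0 _).
have sq (s t : R) (st : s < t) (x : 'rV[R]_d) (x0 : x != 0) :
    normc (qhat gamma psi alpha a b s t x) ^+ 2 <=
    C ^+ 2 * (enorm x `^ e * ((1 + enorm x `^ gamma) ^+ (2 * n) *
      expR (- (2 * nu) * enorm x `^ gamma))).
  have H := HC psi alpha hpsi ak an s t x st x0.
  apply: (@le_trans _ _ ((C * (enorm x `^ order n *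
      ((1 + enorm x `^ gamma) ^+ n * expR (- nu * enorm x `^ gamma)))) ^+ 2)).
    rewrite lerXn2r ?nnegrE ?normc_ge0//.
    by apply: le_trans H; exact: normc_ge0.
  rewrite !exprMn -expRM_natl -[(enorm x `^ order n) ^+ 2]powR_mulrn ?powR_ge0//.
  rewrite -powRrM -exprM.
  rewrite [(n * 2)%N]mulnC [order n * _]mulrC le_eqVlt; apply/orP; left.
  by apply/eqP; do 3!congr (_ * _); congr expR; ring.
have small (s t : R) (st : s < t) (x : 'rV[R]_d) : x != 0 -> enorm x <= 1 ->
    normc (qhat gamma psi alpha a b s t x) ^+ 2 <= A * enorm x `^ e.
  move=> x0 x1; apply: le_trans (sq _ _ st _ x0) _.
  rewrite /A -[X in _ <= X]mulrA; apply: ler_wpM2l; first exact: exprn_ge0.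
  rewrite mulrC.
  apply: ler_wpM2r; first exact: powR_ge0.
  have y0 : 0 <= enorm x `^ gamma by exact: powR_ge0.
  have y1 : enorm x `^ gamma <= 1.
    by rewrite -[leRHS]one ge0_ler_powR ?nnegrE ?enorm_ge0// ltW.
  apply: (@le_trans _ _ (4 ^+ n * 1)); last by rewrite ler_wpM2l ?exprn_ge0// lerDl.
  apply: ler_pM; rewrite ?exprn_ge0 ?addr_ge0 ?expR_ge0//.
    rewrite exprM; apply: lerXn2r; rewrite ?nnegrE ?exprn_ge0 ?addr_ge0// expr2.
    nra.
  by rewrite expR_le1 mulNr oppr_le0 mulr_ge0// mulr_ge0// ltW.
have large (s t : R) (st : s < t) (x : 'rV[R]_d) : 1 <= enorm x ->
    normc (qhat gamma psi alpha a b s t x) ^+ 2 <= A * enorm x `^ (- d.+1%:R).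
  move=> x1; have e0 : 0 < enorm x := lt_le_trans ltr01 x1.
  have x0 : x != 0.
    apply: contraTneq e0 => ->; rewrite -leNgt /enorm big1 ?sqrtr0//.
    by move=> i _; rewrite mxE expr0n.
  apply: le_trans (sq _ _ st _ x0) _.
  rewrite /A -[X in _ <= X]mulrA; apply: ler_wpM2l; first exact: exprn_ge0.
  rewrite -[X in _ <= X]mulrA.
  have K1 := HK _ x1.
  have y1 : 1 <= enorm x `^ gamma.
    by rewrite -[leLHS]one ge0_ler_powR ?nnegrE ?enorm_ge0// ltW.
  set E := expR _ in K1 *.
  have E0 : 0 <= E by exact: expR_ge0.
  have Y : (1 + enorm x `^ gamma) ^+ (2 * n) <= 4 ^+ n * enorm x `^ (gamma * (2 * n)%:R).
    rewrite powRrM powR_mulrn ?powR_ge0// !exprM -exprMn.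
    apply: lerXn2r; rewrite ?nnegrE ?mulr_ge0 ?exprn_ge0 ?addr_ge0 ?powR_ge0// !expr2.
    nra.
  apply: (@le_trans _ _ (4 ^+ n * (enorm x `^ (- d.+1%:R) *
    (enorm x `^ (e + gamma * (2 * n)%:R + d.+1%:R) * E)))).
    apply: (@le_trans _ _ (enorm x `^ e *
        (4 ^+ n * enorm x `^ (gamma * (2 * n)%:R) * E))).
      by rewrite ler_wpM2l ?powR_ge0// ler_wpM2r.
    have pD p q : enorm x `^ (p + q) = enorm x `^ p * enorm x `^ q.
      by rewrite powRD// (gt_eqF e0) implybT.
    rewrite !pD powRN le_eqVlt; apply/orP; left; apply/eqP; field.
    by rewrite gt_eqF// powR_gt0.
  apply: ler_wpM2l; first exact: exprn_ge0.
  rewrite mulrC ler_wpM2r ?powR_ge0//; apply: le_trans K1 _.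
  by rewrite lerDr.
split=> [eps s t eps0 eps1 st|ed s t st].
  exact: (B s t st (small s t st) (large s t st)).1.
exact: (B s t st (small s t st) (large s t st)).2.
Qed.

Lemma mlen_eq0 (alpha : {ffun 'I_d -> nat}) : (mlen alpha == 0%N) = (alpha == 0).
Proof.
apply/idP/eqP => [|->]; last first.
  by rewrite /mlen; under eq_bigr do rewrite ffunE; rewrite big1_eq.
rewrite /mlen sum_nat_eq0 => /forallP H; apply/ffunP => i; rewrite ffunE.
exact/eqP/(implyP (H i)).
Qed.

Lemma qhat_integral_bound : exists2 N : R, 0 <= N &
  forall (psi : R -> 'rV[R]_d -> R[i]) (alpha : {ffun 'I_d -> nat}),
  is_symbol gamma nu psi -> (mlen alpha <= d./2 + 1)%N ->
  let e : R := 2 * (if [&& a == 0%N, b == 0 & alpha != 0]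
    then gamma - (mlen alpha)%:R else gamma * a%:R + b - (mlen alpha)%:R) in
  (forall eps s t : R, 0 < eps -> eps < 1 -> s < t ->
    (\int[lebesgue_rV d]_(xi in [set xi : 'rV[R]_d | (eps <= enorm xi)%R])
       (normc (qhat gamma psi alpha a b s t xi) ^+ 2)%:E <=
     (N * (1 + eps `^ (e + d%:R) + (e == - d%:R)%:R * ln eps^-1))%:E)%E) /\
  (- d%:R < e -> forall s t : R, s < t ->
    (\int[lebesgue_rV d]_xi (normc (qhat gamma psi alpha a b s t xi) ^+ 2)%:E <=
      N%:E)%E).
Proof.
have [N N0 HN] := uniform_constant boundW bound_exists (d./2 + 1).
exists N => // psi alpha hpsi ak e.
by have := HN _ ak psi alpha hpsi ak erefl; rewrite /order mlen_eq0.
Qed.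

End integral_bound.

Theorem lemma3p4 (R : realType) (d : nat) (gamma nu : R) (a : nat) (b : R)
    (hd : (0 < d)%N) (hgamma : 0 < gamma) (hnu : 0 < nu) :
  (exists N : R,
    forall (psi : R -> 'rV[R]_d -> R[i]) (alpha : {ffun 'I_d -> nat}),
    is_symbol gamma nu psi ->
    (mlen alpha <= d./2 + 1)%N ->
    forall eps s t : R, 0 < eps -> eps < 1 -> s < t ->
    let e1 : R := 2 * (gamma - (mlen alpha)%:R) in
    let e2 : R := 2 * (gamma * a%:R + b - (mlen alpha)%:R) in
    (\int[lebesgue_rV d]_(xi in [set xi : 'rV[R]_d | (eps <= enorm xi)%R])
       (Normc.normc (qhat gamma psi alpha a b s t xi) ^+ 2)%:E <=
     (N * [&& a == 0%N, b == 0 & alpha != 0]%:R *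
        (1 + eps `^ (e1 + d%:R) + (e1 == - d%:R)%:R * ln (eps^-1))
      + N * ((a != 0%N)%:R + (b != 0)%:R + (alpha == 0)%:R) *
        (1 + eps `^ (e2 + d%:R) + (e2 == - d%:R)%:R * ln (eps^-1)))%:E)%E)
  /\
  (exists N : R,
    forall (psi : R -> 'rV[R]_d -> R[i]) (alpha : {ffun 'I_d -> nat}),
    is_symbol gamma nu psi ->
    (mlen alpha <= d./2 + 1)%N ->
    [/\ a = 0%N, b = 0, alpha <> 0 & 2 * (gamma - (mlen alpha)%:R) > - d%:R] \/
    2 * (gamma * a%:R + b - (mlen alpha)%:R) > - d%:R ->
    (ereal_sup
       [set x | exists s t : R, (s < t)%R /\
          x = \int[lebesgue_rV d]_xi
                (Normc.normc (qhat gamma psi alpha a b s t xi) ^+ 2)%:E] <=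
     N%:E)%E).
Proof.
have [N N0 HN] := @qhat_integral_bound R d gamma nu a b hd hgamma hnu.
split; exists N => psi alpha hpsi ak; have := HN psi alpha hpsi ak.
  move=> /= [H _] eps s t eps0 eps1 st; apply: le_trans (H _ _ _ eps0 eps1 st) _.
  rewrite lee_fin; case: ifPn => [/and3P[/eqP -> /eqP -> /negbTE ->]|E].
    by rewrite !eqxx /= !addr0 !mulr0 mul0r addr0 mulr1.
  rewrite mulr0 mul0r add0r ler_wpM2r//.
    exact: le_trans ler01 (weight_ge1 _ eps1 eps0).
  rewrite ler_peMr//; move: E; rewrite !negb_and negbK => /or3P[] -> /=;
    rewrite -?addrA ?lerDl ?addr_ge0// addrCA ?lerDl ?addr_ge0//.
  by rewrite addrA addrC lerDl addr_ge0.
move=> /= [_ H] hcase; apply: ub_ereal_sup => _ [s [t [st ->]]].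
apply: H => //; case: ifPn => [/and3P[/eqP a0 /eqP b0 _]|E].
  case: hcase => [[_ _ _]//|]; rewrite a0 b0 mulr0 !add0r => /lt_trans; apply.
  by rewrite ltr_pM2l// ltrDr.
case: hcase => // -[a0 b0 /eqP alpha0 _]; move: E.
by rewrite a0 b0 !eqxx alpha0.
Qed.
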